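(* Let $c_{\mathcal A}>1$ and let $\mathcal A$ be a serial exploration procedure with constant $c_{\mathcal A}$ (as specified in the context). There is a constant $C>0$ depending only on $c_{\mathcal A}$ such that the following holds. Let $k,n$ be positive integers with $6\le\sqrt k\le n$, and consider any $n$-armed bandit instance with a unique best arm and gaps $\Delta_2,\dots,\Delta_n>0$. If the (per-player) time horizon $T$ satisfies $$T\;\ge\; \frac{C}{\sqrt k}\sum_{i=2}^n\frac1{\Delta_i^2}\log\frac n{\Delta_i},$$ then the algorithm One-Round Best-Arm (described in the context), run by $k$ players with horizon $T$, outputs the best arm with probability at least $2/3$. That is, the best arm is identified with probability at least $2/3$ using no more than $O\big(\frac1{\sqrt k}\sum_{i=2}^n\frac1{\Delta_i^2}\log\frac n{\Delta_i}\big)$ arm pulls per player. The algorithm uses a single communication round, in which each player communicates $\tilde O(1)$ bits (its message consists of one arm index and one empirical average reward).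
   Context: Bandit instance: there are $n$ arms; each pull of arm $i$ yields an independent sample of a $[0,1]$-valued reward with unknown expectation $p_i$. For notation only, arms are indexed so that $p_1\ge p_2\ge\dots\ge p_n$ (the players do not know this order). $\Delta_i:=p_1-p_i$. The best arm is the arm of expectation $p_1$; it is assumed unique, so $\Delta_i>0$ for $i\ge2$. There are $k$ players, each pulling arms and observing independent rewards; in a communication round each player broadcasts one message to all others. $\tilde O$ hides polylogarithmic factors, and a communicated numerical value is counted as $\tilde O(1)$ bits. Serial exploration procedure $\mathcal A$ with constant $c_{\mathcal A}>1$: a single-player algorithm which, given a set $A$ of arms and an accuracy $\varepsilon\ge0$ (with the best arm of $A$ unique if $\varepsilon=0$), with probability at least $2/3$ outputs an $\varepsilon$-best arm of $A$ (an arm $i\in A$ with $p_i\ge\max_{l\in A}p_l-\varepsilon$) using no more than $$c_{\mathcal A}\sum_{i\in A,\ i\ne i^\star_A}\frac1{d_i^2}\ln\frac{|A|}{d_i}$$ arm pulls, where $i^\star_A$ is a best arm of $A$ and $d_i:=\max\{\max_{l\in A}p_l-p_i,\ \varepsilon\}$. Algorithm One-Round Best-Arm, with horizon $T$ ($T$ even and $6n/\sqrt k$ an integer): independently, each player $j=1,\dots,k$ (1) chooses a uniformly random subset $A_j$ of $6n/\sqrt k$ arms; (2) Explore: runs $\mathcal A(A_j,0)$ for at most $T/2$ pulls (halting it early if necessary) and lets $i_j$ be its output; if no arm was identified or the procedure did not terminate, $i_j$ is an arbitrary arm; (3) Exploit: pulls arm $i_j$ for $T/2$ times and lets $\hat q_j$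 be the average reward of these pulls; (4) broadcasts $(i_j,\hat q_j)$. Then let $k_i:=|\{j: i_j=i\}|$, $A:=\{i: k_i>\sqrt k\}$, $\hat p_i:=\frac1{k_i}\sum_{j: i_j=i}\hat q_j$, and output $\arg\max_{i\in A}\hat p_i$ (an arbitrary arm if $A=\emptyset$). *)

(* Defs.v *)
From HB Require Import structures.
From mathcomp Require Import all_boot all_order all_algebra.
From mathcomp Require Import all_classical all_reals all_analysis.
Set Implicit Arguments.
Unset Strict Implicit.
Unset Printing Implicit Defensive.
Import Order.TTheory GRing.Theory Num.Theory.
Import numFieldNormedType.Exports.
Local Open Scope classical_set_scope.
Local Open Scope ring_scope.

(* [F i] is the family of events carried by the [i]-th source of randomness. *)
Definition mutually_independent (d : measure_display) (Omega : measurableType d)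
    (R : realType) (P : probability Omega R) (I : eqType)
    (F : I -> set (set Omega)) : Prop :=
  forall (J : seq I) (E : I -> set Omega), uniq J ->
    (forall i, i \in J -> F i (E i)) ->
    P (\big[setI/setT]_(i <- J) E i) = (\prod_(i <- J) P (E i))%E.

(* The arms are 'I_n in an arbitrary order: no monotonicity of the means in the
   index is assumed, since the indices are visible to the players. *)
Record bandit (R : realType) (n : nat) := Bandit {
  reward_law : 'I_n -> probability R R ;
  reward_law01 : forall i, reward_law i `[0, 1]%classic = 1%E }.

Definition mean (R : realType) (n : nat) (nu : bandit R n) (i : 'I_n) : R :=
  Rintegral (reward_law nu i) setT id.

Definition best_in (R : realType) (n : nat) (nu : bandit R n)
    (B : {set 'I_n}) (i : 'I_n) : Prop :=
  i \in B /\ forall l, l \in B -> mean nu l <= mean nu i.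

Definition unique_best_in (R : realType) (n : nat) (nu : bandit R n)
    (B : {set 'I_n}) (i : 'I_n) : Prop :=
  i \in B /\ forall l, l \in B -> l != i -> mean nu l < mean nu i.

(* The observations of a player: arms pulled and rewards received, in order. *)
Definition history (R : realType) (n : nat) := seq ('I_n * R).

(* A decision made from a random seed and the observations so far; it has
   finitely many values in every use below, so measurability amounts to
   measurability of its fibres, for each fixed sequence of pulled arms. *)
Definition measurable_rule (R : realType) (n : nat) (d : measure_display)
    (S : measurableType d) (X : Type) (f : S -> history R n -> X) : Prop :=
  forall (t : nat) (a : t.-tuple 'I_n) (x : X),
    measurable [set z : S * t.-tuple R |
                f z.1 (zip a z.2) = x].

(* [Stop None]: stop without identifying an arm. *)
Inductive action (n : nat) := Pull of 'I_n | Stop of option 'I_n.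
Arguments Stop {n}.

(* A single-player, adaptive and possibly randomized algorithm; its internal
   randomness is a seed drawn once from [seed_law]. *)
Record procedure (R : realType) (n : nat) := Procedure {
  seed_display : measure_display ;
  seed_type : measurableType seed_display ;
  seed_law : probability seed_type R ;
  act : {set 'I_n} -> R -> seed_type -> history R n -> action n ;
  act_measurable : forall B eps, measurable_rule (act B eps) ;
  act_in : forall B eps s h i, act B eps s h = Pull i -> i \in B }.

(* History after at most [t] pulls; [Y u i] is the reward obtained if arm [i] is
   the one pulled at time [u]. *)
Fixpoint run (R : realType) (n : nat) (policy : history R n -> action n)
    (Y : nat -> 'I_n -> R) (t : nat) : history R n :=
  if t is u.+1 then
    let h := run policy Y u in
    if policy h is Pull i then rcons h (i, Y u i) else h
  else [::].

(* The arm output by a policy that is halted after [t] pulls, if there is one. *)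
Definition output_within (R : realType) (n : nat)
    (policy : history R n -> action n) (Y : nat -> 'I_n -> R) (t : nat) :
    option 'I_n :=
  if policy (run policy Y t) is Stop o then o else None.

Section SerialExploration.
Variables (R : realType) (n : nat).

(* Sources of randomness: [None] for the seed, [Some (t, i)] for [Y t i]. *)
Definition serial_randomness (A : procedure R n) (nu : bandit R n)
    (d : measure_display) (Omega : measurableType d) (P : probability Omega R)
    (seed : {RV P >-> seed_type A})
    (Y : nat -> 'I_n -> {RV P >-> R}) : Prop :=
  [/\ forall U, measurable U -> distribution P seed U = seed_law A U,
      forall t i U, measurable U ->
        distribution P (Y t i) U = reward_law nu i U
    & mutually_independent P (fun o : option (nat * 'I_n) =>
        match o with
        | None => preimage_set_system setT seed measurable
        | Some (t, i) => preimage_set_system setT (Y t i) measurable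
        end)].

Definition serial_budget (nu : bandit R n) (c : R) (B : {set 'I_n}) (eps : R)
    (istar : 'I_n) : R :=
  let d i := Num.max (mean nu istar - mean nu i) eps in
  c * \sum_(i in B | i != istar) (d i ^- 2 * ln (#|B|%:R / d i)).

(* Accuracies above 1 are excluded: every arm is then eps-best, but for
   eps > #|B| the budget is negative, so no procedure could respect it. *)
Definition serial_exploration (c : R) (A : procedure R n) : Prop :=
  forall (nu : bandit R n) (B : {set 'I_n}) (eps : R) (istar : 'I_n),
    0 <= eps <= 1 -> best_in nu B istar ->
    (eps = 0 -> unique_best_in nu B istar) ->
  forall (d : measure_display) (Omega : measurableType d)
    (P : probability Omega R) (seed : {RV P >-> seed_type A})
    (Y : nat -> 'I_n -> {RV P >-> R}),
    serial_randomness nu seed Y ->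
    let success : set Omega := [set w | exists (N : nat) (i : 'I_n),
      [/\ N%:R <= serial_budget nu c B eps istar,
          output_within (act B eps (seed w)) (fun t l => Y t l w) N = Some i,
          i \in B & mean nu istar - eps <= mean nu i]] in
    ((2 / 3)%:E <= P success)%E.

End SerialExploration.

Definition message (R : realType) (n : nat) := ('I_n * R)%type.

(* An arm index is sent in binary; a numerical value is charged [w] bits. *)
Definition message_bits (R : realType) (n : nat) (w : nat) (x : message R n) :
  nat := (up_log 2 n + w)%N.

(* An execution of a [k]-player algorithm: the messages broadcast in each of the
   communication rounds, the number of pulls of each player, the final output. *)
Record execution (R : realType) (n k : nat) := Execution {
  rounds : seq ('I_k -> message R n) ;
  pulls : 'I_k -> nat ;
  output : 'I_n }.

Definition bits_sent (R : realType) (n k w : nat) (e : execution R n k)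
    (j : 'I_k) : nat :=
  (\sum_(r <- rounds e) message_bits w (r j))%N.

Section OneRoundBestArm.
Variables (R : realType) (n k : nat).

Section Decision.
Variable msg : 'I_k -> message R n.

Definition votes (i : 'I_n) : nat := #|[pred j | (msg j).1 == i]|.

Definition candidates : {set 'I_n} :=
  [set i : 'I_n | Num.sqrt k%:R < (votes i)%:R :> R].

Definition avg_reward (i : 'I_n) : R :=
  (votes i)%:R^-1 * \sum_(j | (msg j).1 == i) (msg j).2.

Definition maximizers : {set 'I_n} :=
  [set i in candidates | [forall l in candidates,
                            avg_reward l <= avg_reward i]].

End Decision.

(* [fallback j] is player [j]'s arbitrary choice of an arm when exploration does
   not return one.
   [choose] resolves ties in the final argmax; it is only required to select an
   element of nonempty sets, so that [choose set0] is the arbitrary output used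
   when there is no candidate. *)
Variables (A : procedure R n)
  (fallback : 'I_k -> {set 'I_n} -> seed_type A -> history R n -> 'I_n)
  (choose : {set 'I_n} -> 'I_n).

(* The realized randomness: [X j t i] is the reward player [j] gets if it pulls
   arm [i] in time slot [t]. Slots [0 .. T/2 - 1] are reserved for exploration
   (and left idle if it terminates early), slots [T/2 .. T - 1] are used for
   exploitation. *)
Variables (T : nat) (subsets : 'I_k -> {set 'I_n}) (seeds : 'I_k -> seed_type A)
  (X : 'I_k -> nat -> 'I_n -> R).

Definition explore_policy (j : 'I_k) : history R n -> action n :=
  act (subsets j) 0 (seeds j).

Definition explore_history (j : 'I_k) : history R n :=
  run (explore_policy j) (X j) T./2.

Definition explored_arm (j : 'I_k) : 'I_n :=
  odflt (fallback j (subsets j) (seeds j) (explore_history j))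
        (output_within (explore_policy j) (X j) T./2).

Definition exploit_history (j : 'I_k) : history R n :=
  [seq (explored_arm j, X j (T./2 + s)%N (explored_arm j)) | s <- iota 0 T./2].

Definition exploit_average (j : 'I_k) : R :=
  (T./2)%:R^-1 * \sum_(x <- exploit_history j) x.2.

Definition one_round_best_arm : execution R n k :=
  let msg j := (explored_arm j, exploit_average j) in
  {| rounds := [:: msg] ;
     pulls := fun j => (size (explore_history j) + size (exploit_history j))%N ;
     output := choose (maximizers msg) |}.

End OneRoundBestArm.

(* Sources of randomness: [inl (inl j)] for the subset of player [j],
   [inl (inr j)] for its seed, [inr (j, t, i)] for [X j t i]. *)
Definition one_round_randomness (R : realType) (n k m : nat)
    (A : procedure R n) (nu : bandit R n)
    (d : measure_display) (Omega : measurableType d) (P : probability Omega R)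
    (subsets : 'I_k -> Omega -> {set 'I_n})
    (seeds : 'I_k -> {RV P >-> seed_type A})
    (X : 'I_k -> nat -> 'I_n -> {RV P >-> R}) : Prop :=
  [/\ forall j B, measurable (subsets j @^-1` [set B]),
      forall j (B : {set 'I_n}), #|B| = m ->
        P (subsets j @^-1` [set B]) = ('C(n, m)%:R^-1)%:E,
      forall j U, measurable U -> distribution P (seeds j) U = seed_law A U,
      forall j t i U, measurable U ->
        distribution P (X j t i) U = reward_law nu i U
    & mutually_independent P (fun o : 'I_k + 'I_k + 'I_k * nat * 'I_n =>
        match o with
        | inl (inl j) => preimage_set_system setT (subsets j) setT
        | inl (inr j) => preimage_set_system setT (seeds j) measurable
        | inr (j, t, i) => preimage_set_system setT (X j t i) measurable
        end)].

Definition gap (R : realType) (n : nat) (nu : bandit R n) (best i : 'I_n) : R :=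
  mean nu best - mean nu i.

Definition complexity (R : realType) (n : nat) (nu : bandit R n)
    (best : 'I_n) : R :=
  \sum_(i | i != best) (gap nu best i ^- 2 * ln (n%:R / gap nu best i)).

(* Main.v *)
(* Call a player successful if it outputs the best arm. Its random set A_j
   contains the best arm with probability 6/sqrt k; by Markov's inequality over
   these sets, the serial budget of A_j exceeds T/2 with conditional probability
   at most 1/8, so each player succeeds with probability at least
   (2/3) (7/8) 6/sqrt k > 3/sqrt k, and independently of the others. Chebyshev
   then gives more than sqrt k votes for the best arm, except with probability
   1/8. The exploitation rewards are independent of the explored arms, so, given
   those, the average for an arm i with more than sqrt k votes is a mean of more
   than sqrt k T/2 independent rewards, and by Chebyshev it deviates by D/2 with
   probability at most 8/(D^2 sqrt k T). As the hypothesis on T involves the sum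
   of all the 1/D_i^2, this can be summed over all suboptimal arms (comparing
   each with the best arm at its own scale D_i), and no exponential tail bound
   is needed. *)

Require Import Defs.
From HB Require Import structures.
From mathcomp Require Import all_boot all_order all_algebra.
From mathcomp Require Import all_classical all_reals all_analysis.
From mathcomp Require Import measurable_realfun.
From mathcomp Require Import ring lra zify.
Set Implicit Arguments.
Unset Strict Implicit.
Unset Printing Implicit Defensive.
Import Order.TTheory GRing.Theory Num.Theory.
Local Open Scope classical_set_scope.
Local Open Scope ring_scope.

(** * Independence of groups of sigma-algebras *)

Section Independence.
Context d (Omega : measurableType d) (R : realType) (P : probability Omega R).
Implicit Types G H : set (set Omega).

(** Independence from a fixed event survives complements and disjoint countable unions but, in
    general, not intersections; hence a Dynkin system only. *)
Lemma dynkin_indep (F : set Omega) : measurable F ->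
  dynkin [set E | measurable E /\ P (E `&` F) = (P E * P F)%E].
Proof.
move=> mF; split=> /=.
- by split=> //; rewrite setTI probability_setT mul1e.
- move=> E [mE PE]; split; first exact: measurableC.
  rewrite probability_setC// (setIC (~` E)) -setDE measureD//; last first.
    by rewrite ltey_eq fin_num_measure.
  have /= -> := etrans (congr1 P (setIC F E)) PE.
  by rewrite muleBl ?mul1e ?fin_num_measure.
- move=> E tE mE.
  have mE' n : measurable (E n) by case: (mE n).
  split; first exact: bigcupT_measurable.
  rewrite setI_bigcupl !measure_bigcup//=.
  + under eq_eseriesr do rewrite (mE _).2 muleC.
    by rewrite -(@fineK _ (P F)) ?fin_num_measure// nneseriesZl// muleC.
  + by move=> n _; exact: measurableI.
  + move=> i j _ _ [w [[Ei _] [Ej _]]]; apply: tE => //.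
    by exists w.
Qed.

(** Pi-lambda theorem: a Dynkin system containing the pi-system [G] contains the sigma-algebra that
    [G] generates. *)
Lemma indep_g_sigma_algebral G (F : set Omega) : setI_closed G ->
  G `<=` measurable -> measurable F ->
  (forall E, G E -> P (E `&` F) = (P E * P F)%E) ->
  forall E, <<s G >> E -> P (E `&` F) = (P E * P F)%E.
Proof.
move=> GI Gm mF GF E; rewrite -setI_closed_g_dynkin_g_sigma_algebra// => dE.
suff [] : [set E | measurable E /\ P (E `&` F) = (P E * P F)%E] E by [].
by apply: dE; split; [exact: dynkin_indep | move=> X GX; split; auto].
Qed.

Lemma g_sigma_algebra_measurable G :
  G `<=` measurable -> <<s G >> `<=` measurable.
Proof. by apply: smallest_sub; exact: sigma_algebra_measurable. Qed.

(** The one-sided extension is applied twice: to [H] against a fixed event of [<<s G >>], then to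
    [G] against a fixed event of [H]. *)
Lemma indep_g_sigma_algebra G H : setI_closed G -> setI_closed H ->
  G `<=` measurable -> H `<=` measurable ->
  (forall E F, G E -> H F -> P (E `&` F) = (P E * P F)%E) ->
  forall E F, <<s G >> E -> <<s H >> F -> P (E `&` F) = (P E * P F)%E.
Proof.
move=> GI HI Gm Hm GH E F sE sF.
rewrite setIC muleC; apply: (indep_g_sigma_algebral HI) sF => //.
  exact: (g_sigma_algebra_measurable Gm).
move=> {}F HF; rewrite setIC muleC.
by apply: (indep_g_sigma_algebral GI) sE; auto.
Qed.

Section Grouping.
Variables (I : eqType) (F : I -> set (set Omega)).
Hypotheses (Fm : forall i, F i `<=` measurable)
  (FI : forall i, setI_closed (F i)) (FT : forall i, F i setT)
  (indepF : mutually_independent P F).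

(** The union of the families [F i] need not be closed under intersection; these finite
    intersections form a pi-system containing it. *)
Definition cylinders (J : set I) : set (set Omega) :=
  [set E | exists (s : seq I) (e : I -> set Omega),
     [/\ uniq s, forall i, i \in s -> J i, forall i, F i (e i) &
         E = \big[setI/setT]_(i <- s) e i] ].

Lemma big_setI_pred (s : seq I) (Q : pred I) (e : I -> set Omega) :
  \big[setI/setT]_(i <- s) (if Q i then e i else setT) =
  \big[setI/setT]_(i <- [seq i <- s | Q i]) e i.
Proof. by rewrite big_filter [RHS]big_mkcond. Qed.

(** Both index lists are padded with [setT] to a common list, after which the intersection is taken
    index by index inside each [F i]. *)
Lemma setI_closed_cylinders J : setI_closed (cylinders J).
Proof.
move=> _ _ [s [e [us sJ eF ->]]] [t [f [ut tJ fF ->]]].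
pose ext (u : seq I) (g : I -> set Omega) i := if i \in u then g i else setT.
exists (undup (s ++ t)), (fun i => ext s e i `&` ext t f i); split.
- exact: undup_uniq.
- by move=> i; rewrite mem_undup mem_cat => /orP[/sJ|/tJ].
- by move=> i; apply: FI; rewrite /ext; case: ifP.
- rewrite big_split/= (big_setI_pred _ (fun i => i \in s)).
  rewrite (big_setI_pred _ (fun i => i \in t)); congr (_ `&` _).
  + apply: perm_big; apply: uniq_perm => //; first exact/filter_uniq/undup_uniq.
    by move=> i; rewrite mem_filter mem_undup mem_cat; case: (i \in s).
  + apply: perm_big; apply: uniq_perm => //; first exact/filter_uniq/undup_uniq.
    by move=> i; rewrite mem_filter mem_undup mem_cat orbC; case: (i \in t).
Qed.

Lemma cylinders_measurable J : cylinders J `<=` measurable.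
Proof.
move=> _ [s [e [_ _ eF ->]]]; apply: big_ind => //; first exact: measurableI.
by move=> i _; exact: (Fm (eF i)).
Qed.

Lemma sub_cylinders J : \bigcup_(i in J) F i `<=` cylinders J.
Proof.
move=> E [i Ji FE]; exists [:: i], (fun j => if j == i then E else setT).
split => //; first by move=> j; rewrite inE => /eqP ->.
- by move=> j; case: eqP => // ->.
- by rewrite big_seq1 eqxx.
Qed.

(** As [J] and [K] are disjoint, two index lists concatenate without repetition, so mutual
    independence factors the intersection of two cylinders; the pi-lambda argument extends this to
    the generated sigma-algebras. *)
Lemma indep_groups (J K : set I) (E1 E2 : set Omega) : J `&` K = set0 ->
  <<s \bigcup_(i in J) F i >> E1 -> <<s \bigcup_(i in K) F i >> E2 ->
  P (E1 `&` E2) = (P E1 * P E2)%E.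
Proof.
move=> JK sE1 sE2.
apply: (@indep_g_sigma_algebra (cylinders J) (cylinders K));
  try exact: setI_closed_cylinders; try exact: cylinders_measurable.
- move=> _ _ [s [e [us sJ eF ->]]] [t [f [ut tJ fF ->]]].
  have st i : i \in t -> i \notin s.
    move=> /tJ Ki; apply/negP => /sJ Ji.
    by have : (J `&` K) i by []; rewrite JK.
  pose g i := if i \in s then e i else f i.
  have gs : \big[setI/setT]_(i <- s) e i = \big[setI/setT]_(i <- s) g i.
    by apply: eq_big_seq => i si; rewrite /g si.
  have gt : \big[setI/setT]_(i <- t) f i = \big[setI/setT]_(i <- t) g i.
    by apply: eq_big_seq => i /st; rewrite /g => /negbTE ->.
  have gF i : F i (g i) by rewrite /g; case: ifP.
  rewrite gs gt -big_cat !indepF// ?big_cat//= cat_uniq us ut andbT.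
  by apply/hasPn => i /st.
- exact: (sub_sigma_algebra2 (@sub_cylinders _) sE1).
- exact: (sub_sigma_algebra2 (@sub_cylinders _) sE2).
Qed.

End Grouping.
End Independence.

(** * Chebyshev's inequality for pairwise independent bounded variables *)

Section Variance.
Context d (Omega : measurableType d) (R : realType) (P : probability Omega R).
Local Open Scope ereal_scope.

Definition indep_rv (X Y : Omega -> R) := forall U V : set R,
  measurable U -> measurable V ->
  P (X @^-1` U `&` Y @^-1` V) = P (X @^-1` U) * P (Y @^-1` V).

(** By uniqueness of the product measure, the joint law is the product of the two laws; Tonelli then
    separates the integrals. *)
Lemma ge0_integral_mul_indep (X Y : {RV P >-> R}) : indep_rv X Y ->
  (forall w, (0 <= X w)%R) -> (forall w, (0 <= Y w)%R) ->
  \int[P]_w (X w * Y w)%:E = \int[P]_w (X w)%:E * \int[P]_w (Y w)%:E.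
Proof.
move=> XY X0 Y0.
have mZ : measurable_fun setT (fun w => (X w, Y w)).
  by apply: measurable_fun_pair.
pose Z : {mfun Omega >-> (R * R)%type} := mfun_Sub (mem_set mZ).
(* The absolute value makes the integrand nonnegative on the whole line, as Tonelli requires, and
   changes nothing on the values of [X] and [Y]. *)
pose g (x : R) : \bar R := `|x|%:E.
have mabs : measurable_fun [set: R] g.
  by apply/measurable_EFinP; exact: normr_measurable.
pose f (z : R * R) : \bar R := g z.1 * g z.2.
have g0 x : 0 <= g x by rewrite lee_fin.
have mf : measurable_fun setT f.
  by apply: emeasurable_funM; apply: (measurableT_comp mabs).
have f0 z : 0 <= f z by apply: mule_ge0; rewrite lee_fin.
transitivity (\int[distribution P Z]_z f z).
  rewrite ge0_integral_distribution//; apply: eq_integral => w _ /=.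
  by rewrite /f /g /= !ger0_norm.
transitivity (\int[distribution P X \x distribution P Y]_z f z).
  apply: eq_measure_integral => A mA _.
  by symmetry; apply: product_measure_unique => // U V mU mV; exact: XY.
rewrite fubini_tonelli1// /fubini_F.
have -> : \int[P]_w (X w)%:E = \int[distribution P X]_x g x.
  rewrite ge0_integral_distribution//.
  by apply: eq_integral => w _ /=; rewrite /g ger0_norm.
have -> : \int[P]_w (Y w)%:E = \int[distribution P Y]_x g x.
  rewrite ge0_integral_distribution//.
  by apply: eq_integral => w _ /=; rewrite /g ger0_norm.
rewrite -ge0_integralZr//; last exact: integral_ge0.
apply: eq_integral => x _; rewrite /f /=.
by rewrite ge0_integralZl.
Qed.

Section Sum.
Variables (I : eqType) (s : seq I) (Z : I -> {RV P >-> R}).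
Hypothesis uniq_s : uniq s.
Hypothesis indepZ :
  forall i j, i \in s -> j \in s -> i != j -> indep_rv (Z i) (Z j).
Hypothesis Z01 : forall i w, (0 <= Z i w <= 1)%R.

Let mu : R := (\sum_(i <- s) fine 'E_P[Z i])%R.
Let S w : R := (\sum_(i <- s) Z i w)%R.

Let Z0 i w : (0 <= Z i w)%R. Proof. by case/andP: (Z01 i w). Qed.
Let Z1 i w : (Z i w <= 1)%R. Proof. by case/andP: (Z01 i w). Qed.

Let EZ i : \int[P]_w (Z i w)%:E = (fine 'E_P[Z i])%:E.
Proof.
rewrite -expectation_def fineK// expectation_def fin_numE.
have E0 : 0 <= \int[P]_w (Z i w)%:E.
  by apply: integral_ge0 => w _; rewrite lee_fin.
apply/andP; split; first by rewrite gt_eqF// (lt_le_trans _ E0).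
rewrite lt_eqF// (@le_lt_trans _ _ (\int[P]_w 1%:E))//.
  apply: ge0_le_integral => //.
  - by move=> w _; rewrite lee_fin.
  - exact/measurable_EFinP.
  - by move=> w _; rewrite lee_fin.
by rewrite integral_cst//= probability_setT mule1 ltry.
Qed.

Let mZ i : measurable_fun setT (Z i). Proof. by []. Qed.

Let mS : measurable_fun setT S.
Proof. exact: measurable_sum. Qed.

Let ES : \int[P]_w (S w)%:E = mu%:E.
Proof.
under eq_integral do rewrite /S -sumEFin.
rewrite ge0_integral_sum//.
- by rewrite /mu -sumEFin; apply: eq_bigr => i _; rewrite EZ.
- by move=> i; exact/measurable_EFinP.
- by move=> i w _; rewrite lee_fin.
Qed.

Let e0 i : (0 <= fine 'E_P[Z i])%R.
Proof. by rewrite fine_ge0// expectation_ge0. Qed.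

Let mu0 : (0 <= mu)%R. Proof. by apply: sumr_ge0. Qed.

Let S0 w : (0 <= S w)%R. Proof. by apply: sumr_ge0. Qed.

(** Diagonal terms satisfy [Z i ^+ 2 <= Z i] and contribute at most [mu]; off-diagonal terms factor
    by independence and are part of the expansion of [mu ^+ 2]. *)
Let ES2 : \int[P]_w (S w ^+ 2)%:E <= (mu + mu ^+ 2)%:E.
Proof.
have -> : \int[P]_w (S w ^+ 2)%:E =
    \sum_(i <- s) \sum_(j <- s) \int[P]_w (Z i w * Z j w)%:E.
  under eq_integral => w _.
    rewrite expr2 /S mulr_suml -sumEFin.
    under eq_bigr do rewrite mulr_sumr -sumEFin.
    over.
  rewrite ge0_integral_sum//; last 2 first.
    move=> i; apply: emeasurable_sum => j; apply/measurable_EFinP.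
    exact: measurable_funM.
    by move=> i w _; apply: sume_ge0 => j _; rewrite lee_fin mulr_ge0.
  apply: eq_bigr => i _; rewrite ge0_integral_sum//.
    by move=> j; apply/measurable_EFinP; exact: measurable_funM.
  by move=> j w _; rewrite lee_fin mulr_ge0.
have -> : (mu + mu ^+ 2)%:E = \sum_(i <- s) ((fine 'E_P[Z i])%:E +
     \sum_(j <- s) (fine 'E_P[Z i] * fine 'E_P[Z j])%:E).
  rewrite big_split /= sumEFin -/mu EFinD; congr adde.
  rewrite expr2 {1}/mu mulr_suml -sumEFin; apply: eq_bigr => i _.
  by rewrite sumEFin -mulr_sumr.
rewrite big_seq [leRHS]big_seq; apply: lee_sum => i si.
rewrite (bigD1_seq i)//= [X in _ <= _ + X](bigD1_seq i)//= leeD//.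
  rewrite -EZ; apply: ge0_le_integral => //.
  - by move=> w _; rewrite lee_fin mulr_ge0.
  - by apply/measurable_EFinP; exact: measurable_funM.
  - exact/measurable_EFinP.
  - by move=> w _; rewrite lee_fin ler_piMr.
rewrite -[leLHS]add0e leeD ?lee_fin ?mulr_ge0//.
rewrite big_seq_cond [leRHS]big_seq_cond; apply: lee_sum => j /andP[sj ji].
rewrite ge0_integral_mul_indep ?EZ//.
by apply: indepZ => //; rewrite eq_sym.
Qed.

(* All terms of (S - mu)^2 + 2 mu S = S^2 + mu^2 are nonnegative, so
   integrating it requires no integrability argument. *)
Let EV : \int[P]_w ((S w - mu) ^+ 2)%:E <= mu%:E.
Proof.
have mD : measurable_fun setT (fun w => ((S w - mu) ^+ 2)%:E).
  apply/measurable_EFinP; apply: measurable_funX.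
  exact: measurable_funB.
have D0 w : (0 <= (S w - mu) ^+ 2)%R by exact: sqr_ge0.
have : \int[P]_w ((S w - mu) ^+ 2)%:E + \int[P]_w ((2 * mu) * S w)%:E =
       \int[P]_w (S w ^+ 2)%:E + \int[P]_w (mu ^+ 2)%:E.
  rewrite -!ge0_integralD//.
  - by apply: eq_integral => w _; rewrite -!EFinD; congr EFin; ring.
  - by move=> w _; rewrite lee_fin sqr_ge0.
  - by apply/measurable_EFinP; apply: measurable_funX.
  - by move=> w _; rewrite lee_fin sqr_ge0.
  - by move=> w _; rewrite lee_fin.
  - by move=> w _; rewrite lee_fin !mulr_ge0.
  - by apply/measurable_EFinP; apply: measurable_funM.
rewrite integral_cst//= probability_setT mule1.
under [X in _ + X = _]eq_integral do rewrite EFinM.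
rewrite ge0_integralZl_EFin//; last 3 first.
- by move=> w _; rewrite lee_fin.
- exact/measurable_EFinP.
- by rewrite mulr_ge0.
rewrite ES => eqV.
have : \int[P]_w ((S w - mu) ^+ 2)%:E + (2 * mu)%:E * mu%:E <=
    (mu + mu ^+ 2)%:E + (mu ^+ 2)%:E by rewrite eqV leeD2r.
rewrite -EFinM -leeBrDr// => /le_trans; apply.
by rewrite -?(EFinN, EFinD) lee_fin; lra.
Qed.

(** The variance is at most the mean for summands in [0, 1], so Markov's inequality for the squared
    deviation suffices. *)
Lemma chebyshev_sum01 (a : R) : (0 < a)%R ->
  P [set w | (a <= `|S w - mu|)%R] <= (mu / a ^+ 2)%:E.
Proof.
move=> a0.
have mD : measurable_fun setT (fun w => S w - mu)%R by exact: measurable_funB.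
pose D : {RV P >-> R} := mfun_Sub (mem_set mD).
have mM := @markov _ _ _ P D (fun x => x ^+ 2)%R a a0.
have : (a ^+ 2)%:E * P [set w | (a <= `|S w - mu|)%R] <= mu%:E.
  apply: le_trans EV; apply: le_trans (mM _ _ _) _.
  - exact: measurable_funX.
  - by move=> r _; exact: sqr_ge0.
  - by move=> x y; rewrite !nnegrE => x0 y0; rewrite ler_sqr.
  - rewrite unlock le_eqVlt; apply/orP; left; apply/eqP.
    by apply: eq_integral => w _ /=; rewrite real_normK// num_real.
by rewrite -lee_pdivlMl ?exprn_gt0// mulrC EFinM.
Qed.

End Sum.
End Variance.

(** * Transfer to rewards that lie in [0, 1] almost surely *)

Section Clamp.
Context (R : realType).

(* The rewards lie in [0, 1] only almost surely. *)
Definition clamp01 (x : R) : R := Num.max 0 (Num.min x 1).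

Lemma clamp01_ge0_le1 x : 0 <= clamp01 x <= 1.
Proof. by rewrite /clamp01 le_max lexx/= ge_max ler01 ge_min lexx orbT. Qed.

Lemma clamp01_id x : 0 <= x <= 1 -> clamp01 x = x.
Proof. by move=> /andP[x0 x1]; rewrite /clamp01 min_l// max_r. Qed.

Lemma measurable_clamp01 : measurable_fun [set: R] clamp01.
Proof. by apply: measurable_maxr => //; exact: measurable_minr. Qed.

Lemma prob_setC_eq0 d (Omega : measurableType d) (P : probability Omega R)
    (A : set Omega) : measurable A -> P A = 1%E -> P (~` A) = 0%E.
Proof. by move=> mA PA; rewrite probability_setC// PA subee. Qed.

Lemma integral_clamp01 d (Omega : measurableType d) (P : probability Omega R)
    (X : Omega -> R) : measurable_fun setT X ->
  P (X @^-1` `[0, 1]) = 1%E ->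
  (\int[P]_w (X w)%:E = \int[P]_w (clamp01 (X w))%:E)%E.
Proof.
move=> mX PX; apply: ae_eq_integral => //.
- exact/measurable_EFinP.
- by apply/measurable_EFinP; apply: measurableT_comp measurable_clamp01 _.
- exists (~` (X @^-1` `[0, 1])); split.
  + by apply: measurableC; rewrite -[X in measurable X]setTI; exact: mX.
  + apply: prob_setC_eq0 => //.
    by rewrite -[X in measurable X]setTI; exact: mX.
  + by move=> w /= h Xw; apply: h => _; rewrite clamp01_id.
Qed.

Context d (Omega : measurableType d) (P : probability Omega R).

(** After clamping, both sides are integrals of nonnegative functions, so the change of variables
    needs no integrability argument. *)
Lemma expectation_law (X : {RV P >-> R}) (nu : probability R R) :
  (forall U, measurable U -> distribution P X U = nu U) ->
  nu `[0, 1]%classic = 1%E ->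
  fine 'E_P[X] = Rintegral nu setT id.
Proof.
move=> lawX nu01; rewrite expectation_def /Rintegral; congr fine.
rewrite (@integral_clamp01 _ _ P X)//; last by rewrite -nu01 -lawX.
pose g (x : R) : \bar R := (clamp01 x)%:E.
transitivity (\int[distribution P X]_x g x)%E.
  rewrite ge0_integral_distribution//.
    by apply/measurable_EFinP; exact: measurable_clamp01.
  by move=> y; rewrite lee_fin; case/andP: (clamp01_ge0_le1 y).
transitivity (\int[nu]_x g x)%E.
  by apply: eq_measure_integral => A mA _; exact: lawX.
by rewrite (@integral_clamp01 _ _ nu id).
Qed.

(** The clamped variables inherit independence and means, and their sum differs from the original
    one only on a null set. *)
Lemma chebyshev_sum_law (I : choiceType) (s : seq I) (Z : I -> {RV P >-> R})
    (mu : I -> R) (a : R) : uniq s ->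
  (forall i j, i \in s -> j \in s -> i != j -> indep_rv P (Z i) (Z j)) ->
  (forall i, P (Z i @^-1` `[0, 1]) = 1%E) ->
  (forall i, fine 'E_P[Z i] = mu i) -> 0 < a ->
  (P [set w | (a <= `|\sum_(i <- s) Z i w - \sum_(i <- s) mu i|)%R] <=
   ((\sum_(i <- s) mu i) / a ^+ 2)%:E)%E.
Proof.
move=> us iZ Z01 EZ a0.
have mC i : measurable_fun setT (fun w => clamp01 (Z i w)).
  exact: measurableT_comp measurable_clamp01 _.
pose C i : {RV P >-> R} := mfun_Sub (mem_set (mC i)).
have mZ01 i : measurable (Z i @^-1` `[0, 1]).
  by apply: measurable_funPTI => //; exact: measurable_itv.
have EC i : fine 'E_P[C i] = mu i.
  rewrite -EZ !expectation_def; congr fine.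
  by rewrite [RHS]integral_clamp01.
have iC i j : i \in s -> j \in s -> i != j -> indep_rv P (C i) (C j).
  move=> si sj ij U V mU mV.
  apply: (iZ i j si sj ij (clamp01 @^-1` U) (clamp01 @^-1` V));
  by rewrite -[X in measurable X]setTI; exact: measurable_clamp01.
have := chebyshev_sum01 us iC (fun i w => clamp01_ge0_le1 (Z i w)) a0.
under eq_bigr do rewrite EC; move=> /(le_trans _); apply.
(* [N] is the event that some summand leaves [0, 1]: a finite union of null sets. *)
pose N := \big[setU/set0]_(i <- s) ~` (Z i @^-1` `[0, 1]).
have [mN PN] : measurable N /\ P N = 0%E.
  apply: (big_ind (fun A => measurable A /\ P A = 0%E)).
  - by split; rewrite ?measure0.
  - move=> A B [mA A0] [mB B0]; split; first exact: measurableU.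
    by rewrite measureU0.
  - by move=> i _; split; [exact: measurableC | exact: prob_setC_eq0].
have mdev (X : I -> {RV P >-> R}) :
    measurable [set w | a <= `|\sum_(i <- s) X i w - \sum_(i <- s) mu i|].
  rewrite -[X in measurable X]setTI; apply: measurable_fun_le => //.
  apply: measurableT_comp => //; apply: measurable_funB => //.
  exact: measurable_sum.
rewrite -[leRHS](measureU0 (mdev C) mN PN); apply: le_measure.
- by rewrite inE; exact: mdev.
- by rewrite inE; apply: measurableU => //; exact: mdev.
move=> w /= dev.
have [Nw|nNw] := pselect (N w); [by right | left].
under eq_big_seq => i si.
  rewrite /= /C /= clamp01_id; last first.
    apply: contrapT => Zi; apply: nNw; rewrite /N -bigcup_seq; exists i => //.
  over.
by [].
Qed.
End Clamp.

(** * Measurability of runs and outputs *)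

Section CountableMeasurability.
Context d (W : measurableType d).

Lemma measurable_exists_count (I : countType) (F : I -> set W) :
  (forall i, measurable (F i)) -> measurable [set w | exists i, F i w].
Proof.
move=> mF; rewrite (_ : mkset _ = \bigcup_i F i).
  by apply: countable_bigcupT_measurable => //; exact: countableP.
by apply/seteqP; split => w /= [i]; exists i.
Qed.

Lemma measurable_forall_count (I : countType) (F : I -> set W) :
  (forall i, measurable (F i)) -> measurable [set w | forall i, F i w].
Proof.
move=> mF; rewrite (_ : mkset _ = ~` [set w | exists i, (~` F i) w]).
  by apply/measurableC/measurable_exists_count => i; exact: measurableC.
apply/seteqP; split => w /= Fw; first by move=> [i]; apply.
by move=> i; apply: contrapT => nFi; apply: Fw; exists i.
Qed.

Lemma measurable_prop (Q : Prop) : measurable [set _ : W | Q].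
Proof.
have [q|q] := pselect Q.
  by rewrite (_ : mkset _ = setT)//; apply/seteqP; split.
by rewrite (_ : mkset _ = set0)//; apply/seteqP; split.
Qed.

(** Splitting along the countably many values of [f] lets a discrete intermediate result, such as a
    random subset or a vector of arms, be frozen before measurability is checked. *)
Lemma measurable_finvalued (I : countType) (Y : Type)
    (f : W -> I) (g : I -> W -> Y) y :
  (forall i, measurable [set w | f w = i]) ->
  (forall i, measurable [set w | g i w = y]) ->
  measurable [set w | g (f w) w = y].
Proof.
move=> mf mg.
rewrite (_ : mkset _ =
  [set w | exists i, ([set w | f w = i] `&` [set w | g i w = y]) w]).
  by apply: measurable_exists_count => i; exact: measurableI.
apply/seteqP; split => w /=; first by move=> E; exists (f w).
by case=> i [/= -> ].
Qed.

End CountableMeasurability.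

Section Runs.
Context (R : realType) (n : nat).
Implicit Types (policy : history R n -> action n) (Y : nat -> 'I_n -> R).

(* Until it stops, a run pulls once per slot, so the entry of index u in a
   history is a reward drawn in slot u. *)
Fixpoint rewards Y (u : nat) (a : seq 'I_n) : seq R :=
  if a is i :: b then Y u i :: rewards Y u.+1 b else [::].

Lemma size_rewards Y u a : size (rewards Y u a) = size a.
Proof. by elim: a u => //= i a IH u; rewrite IH. Qed.

Lemma rewards_rcons Y u a i :
  rewards Y u (rcons a i) = rcons (rewards Y u a) (Y (u + size a)%N i).
Proof. by elim: a u => [|x a IH] u /=; rewrite ?addn0// IH addSnnS. Qed.

Lemma size_run policy Y t : (size (run policy Y t) <= t)%N.
Proof.
elim: t => //= t IH; case: (policy _) => [i|o]; last exact: leqW.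
by rewrite size_rcons.
Qed.

(** A stop freezes the history and hence repeats forever, so a policy that still pulls at time [t]
    has pulled in every earlier slot. *)
Lemma run_full policy Y t i : policy (run policy Y t) = Pull i ->
  size (run policy Y t) = t.
Proof.
elim: t i => //= t IH i.
case E: (policy (run policy Y t)) => [l|o]; last by rewrite E.
by rewrite size_rcons (IH _ E).
Qed.

(** A history is determined by its list of arms and the reward array. Once this list is frozen, only
    real-valued rewards vary, which is the setting of [measurable_rule]. *)
Lemma run_zip policy Y t :
  run policy Y t =
  zip (unzip1 (run policy Y t)) (rewards Y 0 (unzip1 (run policy Y t))).
Proof.
elim: t => //= t IH; case E: (policy (run policy Y t)) => [i|o]; last exact: IH.
rewrite {1 2}/unzip1 map_rcons -/(unzip1 _) rewards_rcons.
rewrite zip_rcons ?size_rewards//.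
by rewrite -IH add0n size_map (run_full E).
Qed.

Lemma run_stop policy Y t u o :
  policy (run policy Y t) = Stop o -> (t <= u)%N ->
  run policy Y u = run policy Y t.
Proof.
move=> E /subnK <-; elim: (u - t)%N => //= v IH.
by rewrite IH E.
Qed.

(** Needed to pass from the random number of pulls in the serial guarantee to the fixed exploration
    length. *)
Lemma output_within_mono policy Y t u i : (t <= u)%N ->
  output_within policy Y t = Some i -> output_within policy Y u = Some i.
Proof.
rewrite /output_within => tu.
by case E: (policy (run policy Y t)) => [//|o] oi; rewrite (run_stop E tu) E.
Qed.

End Runs.

Section MeasurableRuns.
Context (R : realType) (n : nat) (A : procedure R n).
Context d (W : measurableType d) (seed : W -> seed_type A)
  (Y : nat -> 'I_n -> W -> R) (N : nat) (B : {set 'I_n}) (eps : R).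
Hypothesis mseed : measurable_fun setT seed.
Hypothesis mY : forall t i, (t < N)%N -> measurable_fun setT (Y t i).

Let policy w := act B eps (seed w).
Let Yw w t i := Y t i w.

(** Only slots below [N] are assumed measurable, so that these results also apply on the
    sigma-algebra of the exploration slots alone; hence the length bounds. *)
Lemma measurable_nth_rewards (a : seq 'I_n) u v : (u + size a <= N)%N ->
  (v < size a)%N -> measurable_fun setT (fun w => nth 0 (rewards (Yw w) u a) v).
Proof.
elim: a u v => // i a IH u [|v] /= uN va; first by apply: mY; lia.
by apply: IH; lia.
Qed.

Lemma measurable_rule_rewards (X : Type) (f : seed_type A -> history R n -> X)
    (a : seq 'I_n) x : measurable_rule f -> (size a <= N)%N ->
  measurable [set w | f (seed w) (zip a (rewards (Yw w) 0 a)) = x].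
Proof.
move=> mf aN.
pose g w : (size a).-tuple R := Tuple (introT eqP (size_rewards (Yw w) 0 a)).
have mg : measurable_fun setT g.
  apply/measurable_fun_tnthP => i.
  have := @measurable_nth_rewards a 0 i aN (ltn_ord i).
  apply: eq_measurable_fun => w _ /=.
  by rewrite (tnth_nth 0).
have mG : measurable_fun setT (fun w => (seed w, g w)).
  exact: measurable_fun_pair.
have := mG measurableT _ (mf (size a) (in_tuple a) x).
by rewrite setTI.
Qed.

(** Induction on time: the list is [a] after one more slot either because it was [a] and the policy
    stopped, or because the last arm of [a] has just been pulled. In each case the policy is
    evaluated along a frozen list of arms. *)
Lemma measurable_arms_run t (a : seq 'I_n) : (size a <= N)%N ->
  measurable [set w | unzip1 (run (policy w) (Yw w) t) = a].
Proof.
elim: t a => [|t IH] a aN /=.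
  exact: (measurable_prop _ (_ = _)).
have mS (b : seq 'I_n) o : (size b <= N)%N ->
    measurable [set w | policy w (zip b (rewards (Yw w) 0 b)) = o].
  by move=> bN; apply: measurable_rule_rewards bN; exact: act_measurable.
pose stopped := [set w | unzip1 (run (policy w) (Yw w) t) = a] `&`
  \bigcup_o [set w | policy w (zip a (rewards (Yw w) 0 a)) = Stop o].
have mstopped : measurable stopped.
  apply: measurableI; first exact: IH.
  apply: countable_bigcupT_measurable => [|o]; last exact: mS.
  exact: countableP.
have stoppedP w : unzip1 (run (policy w) (Yw w) t) = a ->
    policy w (run (policy w) (Yw w) t) = policy w (zip a (rewards (Yw w) 0 a)).
  by move=> E; rewrite run_zip E.
(* An empty list can only result from a stop; a list [rcons b i] may also result from pulling [i]
   after [b]. *)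
case: (lastP a) aN @stopped mstopped stoppedP => [|b i] aN stopped mst stP.
  rewrite (_ : mkset _ = stopped)//; apply/seteqP; split => w /=.
    case E: (policy w (run (policy w) (Yw w) t)) => [i|o] Ea.
      by move: Ea => /(congr1 size); rewrite size_map size_rcons.
    by split => //; exists o => //=; rewrite -stP.
  by case=> Ea [ o _ /=]; rewrite -stP// => ->.
rewrite (_ : mkset _ = stopped `|`
  ([set w | unzip1 (run (policy w) (Yw w) t) = b] `&`
   [set w | policy w (zip b (rewards (Yw w) 0 b)) = Pull i])); last first.
  apply/seteqP; split => w /=.
    case E: (policy w (run (policy w) (Yw w) t)) => [l|o] Ea.
      right; move: Ea; rewrite /unzip1 map_rcons => /rcons_inj[Eb <-] /=.
      by split=> //; rewrite -E [in RHS]run_zip /unzip1 Eb.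
    by left; split=> //; exists o => //=; rewrite -stP.
  case=> [[Ea [ o _ /=]]|[Eb Ei]]; first by rewrite -stP// => ->.
  by rewrite run_zip Eb Ei /unzip1 map_rcons -/(unzip1 _) -Eb -run_zip.
rewrite size_rcons in aN.
apply: measurableU => //; apply: measurableI; first by apply: IH; lia.
by apply: mS; lia.
Qed.

Lemma measurable_run_rule (X : Type) (f : seed_type A -> history R n -> X) t x :
  measurable_rule f -> (t <= N)%N ->
  measurable [set w | f (seed w) (run (policy w) (Yw w) t) = x].
Proof.
move=> mf tN.
(* The event is split over the countably many arm lists; those longer than [N] cannot occur by time
   [t]. *)
pose D (a : seq 'I_n) := if (size a <= N)%N then
   [set w | unzip1 (run (policy w) (Yw w) t) = a] `&`
   [set w | f (seed w) (zip a (rewards (Yw w) 0 a)) = x] else set0.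
rewrite (_ : mkset _ = \bigcup_a D a).
  apply: countable_bigcupT_measurable => [|a]; first exact: countableP.
  rewrite /D; case: ifP => // aN; apply: measurableI.
    exact: measurable_arms_run.
  exact: measurable_rule_rewards.
apply/seteqP; split => w /=.
  move=> E; exists (unzip1 (run (policy w) (Yw w) t)) => //.
  rewrite /D size_map (leq_trans (size_run _ _ _) tN); split => //=.
  by rewrite -run_zip.
by move=> [a _]; rewrite /D; case: ifP => // _ [/= Ea]; rewrite -Ea -run_zip.
Qed.

End MeasurableRuns.

Section MeasurableOneRound.
Context (R : realType) (n k : nat) (A : procedure R n)
  (fallback : 'I_k -> {set 'I_n} -> seed_type A -> history R n -> 'I_n)
  (choose : {set 'I_n} -> 'I_n) (T : nat)
  d (W : measurableType d) (sub : 'I_k -> W -> {set 'I_n})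
  (seeds : 'I_k -> W -> seed_type A) (X : 'I_k -> nat -> 'I_n -> W -> R).
Hypothesis mfallback : forall j B, measurable_rule (fallback j B).

Definition arm_of j w := explored_arm fallback T
  (fun j => sub j w) (fun j => seeds j w) (fun j t i => X j t i w) j.

(** The decision inside [output_within], detached from the run so that it is a rule of seed and
    history. *)
Definition stop_rule B eps (s : seed_type A) (h : history R n) : option 'I_n :=
  if act B eps s h is Stop o then o else None.

Lemma measurable_stop_rule B eps : measurable_rule (stop_rule B eps).
Proof.
move=> t a o.
pose Z : measurableType _ := (seed_type A * t.-tuple R)%type.
pose S i : set Z := [set z : Z | act B eps z.1 (zip a z.2) = Stop (Some i)].
have mS i : measurable (S i) by exact: act_measurable.
case: o => [i|].
  rewrite (_ : mkset _ = S i)//.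
  apply/seteqP; split => z; rewrite /S /stop_rule /=.
    by case: (act _ _ _ _) => // o ->.
  by move=> ->.
(* The value [None] covers both pulling and stopping without an arm, so its fibre is obtained as a
   complement. *)
rewrite (_ : mkset _ = [set z : Z | forall i, (~` S i) z]).
  by apply: measurable_forall_count => i; exact: measurableC.
apply/seteqP; split => z; rewrite /S /stop_rule /=.
  by case: (act _ _ _ _) => [//|o] ->.
by case: (act _ _ _ _) => [//|[i /(_ i)|]].
Qed.

Definition explore_rule j B s (h : history R n) : 'I_n :=
  odflt (fallback j B s h) (stop_rule B 0 s h).

Lemma measurable_explore_rule j B : measurable_rule (explore_rule j B).
Proof.
move=> t a i.
pose Z : measurableType _ := (seed_type A * t.-tuple R)%type.
apply: (@measurable_finvalued _ Z _ _
  (fun z : Z => stop_rule B 0 z.1 (zip a z.2))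
  (fun o z => odflt (fallback j B z.1 (zip a z.2)) o)) => o.
  exact: measurable_stop_rule.
case: o => [l|]; last exact: mfallback.
exact: (measurable_prop _ (_ = _)).
Qed.

Lemma measurable_arm_of j i :
  (forall B, measurable (sub j @^-1` [set B])) ->
  measurable_fun setT (seeds j) ->
  (forall t i, (t < T./2)%N -> measurable_fun setT (X j t i)) ->
  measurable [set w | arm_of j w = i].
Proof.
move=> msub mseeds mX.
apply: (@measurable_finvalued _ _ _ _ (sub j) (fun B w => explore_rule j B
  (seeds j w) (run (act B 0 (seeds j w)) (fun t i => X j t i w) T./2))).
  exact: msub.
move=> B; apply: (@measurable_run_rule _ _ A _ W (seeds j) (X j) T./2 B 0
  _ _ _ (explore_rule j B) T./2 i) => //.
exact: measurable_explore_rule.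
Qed.

(** The messages with the explored arms replaced by a frozen vector [a]: they depend on the
    exploitation slots only, which separates the two phases. *)
Definition sample_mean (a : {ffun 'I_k -> 'I_n}) (w : W) (j : 'I_k) :
    message R n :=
  (a j, (T./2)%:R^-1 * \sum_(s <- iota 0 T./2) X j (T./2 + s)%N (a j) w).

Definition exec_of w := one_round_best_arm fallback choose T
  (fun j => sub j w) (fun j => seeds j w) (fun j t i => X j t i w).

Lemma output_exec_of w : output (exec_of w) =
  choose (maximizers (sample_mean [ffun j => arm_of j w] w)).
Proof.
rewrite /exec_of /=; congr (choose (maximizers _)); apply/funext => j.
by rewrite /sample_mean ffunE /exploit_average /exploit_history big_map.
Qed.

Lemma measurable_avg_reward a i :
  (forall j t i, (T./2 <= t)%N -> measurable_fun setT (X j t i)) ->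
  measurable_fun setT (fun w => avg_reward (sample_mean a w) i).
Proof.
move=> mX; apply: measurable_funM.
  rewrite (_ : (fun _ => _) = cst (#|[pred j | a j == i]|%:R^-1)) //.
apply: (eq_measurable_fun (fun w => \sum_j
  (if a j == i then (sample_mean a w j).2 else 0))) => [w _|].
  by rewrite [RHS]big_mkcond.
apply: measurable_sum => j; case: (_ == _) => //.
apply: measurable_funM => //; apply: measurable_sum => s; apply: mX.
exact: leq_addr.
Qed.

(** First the vector of explored arms is frozen, then the set of maximizers; [choose] is then
    applied to a constant. *)
Lemma measurable_output i :
  (forall j B, measurable (sub j @^-1` [set B])) ->
  (forall j, measurable_fun setT (seeds j)) ->
  (forall j t i, measurable_fun setT (X j t i)) ->
  measurable [set w | output (exec_of w) = i].
Proof.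
move=> msub mseeds mX; under eq_set do rewrite output_exec_of.
apply: (@measurable_finvalued _ _ _ _ (fun w => [ffun j => arm_of j w])
  (fun a w => choose (maximizers (sample_mean a w)))).
  move=> a; rewrite (_ : mkset _ =
    [set w | forall j, [set w | arm_of j w = a j] w]).
    apply: measurable_forall_count => j.
    by apply: measurable_arm_of => // *; exact: mX.
  apply/seteqP; split => w /=; first by move=> <- j; rewrite ffunE.
  by move=> E; apply/ffunP => j; rewrite ffunE.
move=> a; apply: (@measurable_finvalued _ _ _ _
  (fun w => maximizers (sample_mean a w)) (fun M _ => choose M)) => M;
  last first.
  exact: (measurable_prop _ (_ = _)).
pose C : {set 'I_n} :=
  [set i : 'I_n | Num.sqrt k%:R < #|[pred j | a j == i]|%:R :> R]%SET.
have CE w : candidates (sample_mean a w) = C by [].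
rewrite (_ : mkset _ = [set w | forall i,
    [set w | (i \in maximizers (sample_mean a w)) = (i \in M)] w]);
  last by apply/seteqP; split => w /=; [move=> -> | move=> E; apply/setP].
apply: measurable_forall_count => l.
have mE w : (l \in maximizers (sample_mean a w)) = (l \in C) && [forall q in C,
    avg_reward (sample_mean a w) q <= avg_reward (sample_mean a w) l].
  by rewrite /maximizers CE finset.in_set.
have mI : measurable [set w | l \in maximizers (sample_mean a w)].
  rewrite (_ : mkset _ = [set w | forall q, [set w | (l \in C) && ((q \in C) ==>
      (avg_reward (sample_mean a w) q <= avg_reward (sample_mean a w) l))] w]).
    apply: measurable_forall_count => q.
    case: (l \in C); case: (q \in C); rewrite /=; [|exact: measurable_prop..].
    rewrite -[X in measurable X]setTI; apply: measurable_fun_le => //;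
      by apply: measurable_avg_reward => *; exact: mX.
  apply/seteqP; split => w /=; rewrite mE.
    by move=> /andP[-> /forallP] /=.
  move=> h. apply/andP; split; first by have /= /andP[] := h l.
  by apply/forallP => q; have /= /andP[] := h q.
case: (l \in M) => //.
rewrite (_ : mkset _ = ~` [set w | l \in maximizers (sample_mean a w)]).
  exact: measurableC.
by apply/seteqP; split => w /=; [move=> ->|move=> /negP/negbTE].
Qed.

End MeasurableOneRound.

(** * Counting the subsets that contain the best arm *)

Section Subsets.
Context (R : realType) (n : nat).
Implicit Types B D : {set 'I_n}.

(** Complementation turns these supersets of [D] into the subsets of its complement of size
    [n - m]. *)
Lemma card_supsets D m : (#|D| <= m <= n)%N ->
  #|[set B : {set 'I_n} | (D \subset B) && (#|B| == m)]%SET| =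
  'C(n - #|D|, m - #|D|).
Proof.
move=> /andP[Dm mn].
have -> : [set B : {set 'I_n} | (D \subset B) && (#|B| == m)]%SET =
    [set ~: B | B in
      [set B : {set 'I_n} | B \subset ~: D & #|B| == (n - m)%N]]%SET.
  have cC B : #|~: B|%SET = (n - #|B|)%N.
    by rewrite cardsCs finset.setCK card_ord.
  apply/setP => B; rewrite finset.inE; apply/idP/imsetP.
    move=> /andP[DB /eqP Bm]; exists (~: B)%SET; last by rewrite finset.setCK.
    by rewrite !finset.inE finset.setCS DB cC Bm eqxx.
  move=> [B' ]; rewrite !finset.inE => /andP[B'D /eqP B'm] ->.
  by rewrite finset.subsetC B'D cC B'm subKn/=.
rewrite card_imset; last exact: inv_inj finset.setCK.
rewrite cards_draws cardsCs finset.setCK card_ord.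
have -> : (m - #|D| = (n - #|D|) - (n - m))%N by lia.
by rewrite bin_sub//; lia.
Qed.

Variables (best : 'I_n) (m : nat).
Hypothesis m_gt0 : (0 < m)%N.
Hypothesis mn : (m <= n)%N.

Definition msets : {set {set 'I_n}} :=
  [set B : {set 'I_n} | (best \in B) && (#|B| == m)]%SET.

Lemma card_msets : #|msets| = 'C(n.-1, m.-1).
Proof.
rewrite -subn1 -(subn1 m) -(cards1 best) -card_supsets ?cards1 ?m_gt0//.
by apply: eq_card => B; rewrite !finset.inE finset.sub1set.
Qed.

Lemma bin_msets : (n * #|msets| = m * 'C(n, m))%N.
Proof. by rewrite card_msets mul_bin_diag prednK. Qed.

(** Among the sets containing [best], a given other arm has frequency (m-1)/(n-1), which is at most
    m/n. *)
Lemma card_msets2 i : i != best ->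
  (n * #|[set B in msets | i \in B]%SET| <= m * #|msets|)%N.
Proof.
move=> ib.
have n1 : (1 < n)%N.
  have := cardsT 'I_n; rewrite card_ord => <-.
  rewrite (leq_trans _ (subset_leq_card (finset.subsetT [set i; best]%SET)))//.
  by rewrite cards2 ib.
(* For [m = 1] no set contains both arms, whereas truncated subtraction would make the binomial
   count 1. *)
case: (ltnP 1 m) => m1; last first.
  rewrite (_ : [set _ in _ | _]%SET = finset.set0) ?cards0 ?muln0//.
  apply/setP => B; rewrite !finset.inE.
  apply/negP => /andP[/andP[bB /eqP Bm] iB].
  have : (2 <= #|B|)%N.
    rewrite (leq_trans _ (subset_leq_card (_ : [set i; best]%SET \subset B)))//.
      by rewrite cards2 ib.
    by apply/fintype.subsetP => l; rewrite !finset.inE => /orP[]/eqP ->.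
  by rewrite Bm leqNgt ltnS m1.
have -> : #|[set B in msets | i \in B]%SET| = 'C(n.-2, m.-2).
  have c2 : #|[set best; i]%SET| = 2 by rewrite cards2 eq_sym ib.
  rewrite (_ : n.-2 = n - #|[set best; i]%SET|)%N; last by rewrite c2; lia.
  rewrite (_ : m.-2 = m - #|[set best; i]%SET|)%N; last by rewrite c2; lia.
  rewrite -card_supsets; last by rewrite c2; lia.
  apply: eq_card => B; rewrite !finset.inE finset.subUset !finset.sub1set.
  by rewrite -!andbA; congr andb; rewrite andbC.
(* After absorption of the binomials there remains n(m-1) <= (n-1)m, that is, m <= n. *)
have := mul_bin_diag n.-1 m.-2.
rewrite card_msets (_ : m.-2.+1 = m.-1); last by lia.
set a := 'C(_, _); set b := 'C(_, _) => E.
have n10 : (0 < n.-1)%N by lia.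
rewrite -(leq_pmul2l n10) mulnCA E mulnA mulnA leq_mul2r; apply/orP; right.
nia.
Qed.

(** Markov's inequality for a uniform set in [msets], cleared of denominators; exchanging the sums
    over sets and arms reduces the mean to the frequencies bounded above. *)
Lemma markov_msets (v : 'I_n -> R) (N : R) : (forall i, 0 <= v i) ->
  n%:R * N *
    #|[set B in msets | (N < \sum_(i in B | i != best) v i)%R]%SET|%:R <=
  m%:R * #|msets|%:R * \sum_(i | i != best) v i.
Proof.
move=> v0; pose V (B : {set 'I_n}) := \sum_(i in B | i != best) v i.
rewrite -/V.
have -> : m%:R * #|msets|%:R * (\sum_(i | i != best) v i) =
    \sum_(i | i != best) (m * #|msets|)%:R * v i :> R.
  by rewrite mulr_sumr natrM.
apply: (@le_trans _ _ (n%:R * \sum_(B in msets) V B)).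
  rewrite -mulrA ler_wpM2l//.
  rewrite -sum1_card natr_sum mulr_sumr.
  apply: (@le_trans _ _ (\sum_(B in [set B in msets | N < V B]%SET) V B)).
    by apply: ler_sum => B; rewrite finset.inE mulr1 => /andP[_ /ltW].
  rewrite [leRHS](bigID [pred B | N < V B])/=.
  rewrite (eq_bigl (fun B => (B \in msets) && (N < V B))).
    by rewrite lerDl; apply: sumr_ge0 => B _; apply: sumr_ge0.
  by move=> B; rewrite finset.inE.
rewrite /V; under eq_bigr do rewrite big_mkcondl/= big_mkcond/=.
rewrite exchange_big/= mulr_sumr [leRHS]big_mkcond/=; apply: ler_sum => i _.
case: ifPn => [ib|]; last by rewrite big1 ?mulr0.
rewrite -big_mkcondr/= sumr_const -[v i *+ _]mulr_natl mulrA -natrM.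
rewrite ler_wpM2r// ler_nat.
apply: leq_trans (card_msets2 ib); rewrite leq_mul2l; apply/orP; right.
apply: subset_leq_card; apply/fintype.subsetP => B.
by rewrite unfold_in => iB; rewrite finset.inE.
Qed.

End Subsets.

(** * Total probability, union bound and subfamilies of independent sources *)

Section ProbabilityHelpers.
Context d (Omega : measurableType d) (R : realType) (P : probability Omega R).

Lemma fsbig_fin (I : finType) (f : I -> \bar R) :
  (\sum_(i \in [set: I]) f i = \sum_i f i)%E.
Proof.
rewrite [RHS]bigfs ?index_enum_uniq//; last first.
  by move=> i _; rewrite mem_index_enum.
by rewrite (_ : [set` _] = setT)//; apply/seteqP; split.
Qed.

Lemma prob_total (I : finType) (f : Omega -> I) (E : set Omega) :
  (forall i, measurable [set w | f w = i]) -> measurable E ->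
  P E = (\sum_i P (E `&` [set w | f w = i]))%E.
Proof.
move=> mf mE.
have EU : E = \bigcup_(i in setT) (E `&` [set w | f w = i]).
  by apply/seteqP; split => w; [move=> Ew; exists (f w)|case=> i _ []].
rewrite [in LHS]EU measure_fin_bigcup //; last 3 first.
- exact: finite_finset.
- by move=> i j _ _ [w [[_ <-] [_ <-]]].
- by move=> i _; exact: measurableI.
exact: fsbig_fin.
Qed.

Lemma prob_exists_le (I : finType) (Q : pred I) (F : I -> set Omega) :
  (forall i, measurable (F i)) ->
  (P [set w | exists2 i, Q i & F i w] <= \sum_(i | Q i) P (F i))%E.
Proof.
move=> mF.
pose G i := if Q i then F i else set0.
have mG i : measurable (G i) by rewrite /G; case: ifP.
have E : [set w | exists2 i, Q i & F i w] = \bigcup_i G i.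
  apply/seteqP; split => w /=.
    by move=> [i Qi Fi]; exists i; rewrite // /G Qi.
  by move=> [i _]; rewrite /G; case: ifP => // Qi Fi; exists i.
have mE : measurable [set w | exists2 i, Q i & F i w].
  by rewrite E; apply: countable_bigcupT_measurable => //; exact: countableP.
rewrite big_mkcond/= (_ : (\sum_i _)%E = (\sum_i P (G i))%E); last first.
  by apply: eq_bigr => i _; rewrite /G; case: ifP => // _; rewrite measure0.
rewrite -fsbig_fin; apply: content_sub_fsum => //; first exact: finite_finset.
by rewrite E.
Qed.

(** Used to extract the randomness of a single player from that of all players. *)
Lemma mutually_independent_sub (I I' : eqType) (F : I -> set (set Omega))
    (F' : I' -> set (set Omega)) (g : I' -> I) : injective g ->
  (forall i, F' i `<=` F (g i)) ->
  mutually_independent P F -> mutually_independent P F'.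
Proof.
move=> ginj F'F iF [|i0 s] E us sE; first by rewrite !big_nil probability_setT.
set J := i0 :: s in us sE *.
(* A preimage under [g] is recovered from its position in the list; [i0] is merely the default,
   which is why the empty list was treated apart. *)
pose e o := E (nth i0 J (index o (map g J))).
have eg i : i \in J -> e (g i) = E i.
  by move=> iJ; rewrite /e index_map// nth_index.
transitivity (P (\big[setI/setT]_(o <- map g J) e o)).
  by rewrite big_map; congr (P _); apply: eq_big_seq => i iJ; rewrite eg.
rewrite iF.
- by rewrite big_map; apply: eq_big_seq => i iJ; rewrite eg.
- by rewrite map_inj_uniq.
- by move=> _ /mapP[i iJ ->]; rewrite eg//; apply: F'F; exact: sE.
Qed.

End ProbabilityHelpers.

(** * The one-round algorithm *)

Section OneRoundAnalysis.
Context (R : realType) (n k m : nat) (A : procedure R n) (nu : bandit R n)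
  (fallback : 'I_k -> {set 'I_n} -> seed_type A -> history R n -> 'I_n)
  d (Omega : measurableType d) (P : probability Omega R)
  (subsets : 'I_k -> Omega -> {set 'I_n})
  (seeds : 'I_k -> {RV P >-> seed_type A})
  (X : 'I_k -> nat -> 'I_n -> {RV P >-> R}) (T : nat).
Hypothesis mfallback : forall j B, measurable_rule (fallback j B).
Hypothesis hrand : one_round_randomness m nu subsets seeds X.
Local Notation N := T./2.

Definition source : Type := ('I_k + 'I_k + 'I_k * nat * 'I_n)%type.

Definition info (o : source) : set (set Omega) :=
  match o with
  | inl (inl j) => preimage_set_system setT (subsets j) setT
  | inl (inr j) => preimage_set_system setT (seeds j) measurable
  | inr (j, t, i) => preimage_set_system setT (X j t i) measurable
  end.

Let msubsets j B : measurable (subsets j @^-1` [set B]).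
Proof. by case: hrand. Qed.

Let info_indep : mutually_independent P info.
Proof. by case: hrand. Qed.

Let info_measurable o : info o `<=` measurable.
Proof.
case: o => [[j|j]|[[j t] i]] _ [U mU <-]; rewrite setTI.
- rewrite (_ : _ @^-1` _ = [set w | exists B, (U B /\ subsets j w = B)]).
    apply: measurable_exists_count => B; apply: measurableI.
      exact: (measurable_prop _ (U B)).
    exact: msubsets.
  apply/seteqP; split => w /=; last by move=> [B [UB ->]].
  by move=> Uw; exists (subsets j w).
- by rewrite -[X in measurable X]setTI; exact: measurable_funP.
- by rewrite -[X in measurable X]setTI; exact: measurable_funP.
Qed.

Let info_setI o : setI_closed (info o).
Proof.
case: o => [[j|j]|[[j t] i]] _ _ [U mU <-] [V mV <-];
  rewrite setIACA setIid -preimage_setI; exists (U `&` V) => //;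
  exact: measurableI.
Qed.

Let info_setT o : info o setT.
Proof.
by case: o => [[j|j]|[[j t] i]]; exists setT; rewrite ?setTI.
Qed.

Lemma indep_sources (J K : set source) (E1 E2 : set Omega) : J `&` K = set0 ->
  <<s \bigcup_(i in J) info i >> E1 -> <<s \bigcup_(i in K) info i >> E2 ->
  P (E1 `&` E2) = (P E1 * P E2)%E.
Proof. exact: indep_groups. Qed.

(* An event is shown to belong to the sigma-algebra generated by the sources in
   J by instantiating on this type the general measurability lemmas above. *)
Definition sub_algebra (J : set source) :=
  g_sigma_algebraType (\bigcup_(o in J) info o).

Section SubAlgebra.
Variable J : set source.
Let W : measurableType _ := sub_algebra J.

Lemma measurable_subsets j B : J (inl (inl j)) ->
  measurable (subsets j @^-1` [set B] : set W).
Proof.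
move=> Jj; apply: sub_sigma_algebra; exists (inl (inl j)) => //.
by exists [set B]; rewrite ?setTI.
Qed.

Lemma measurable_seeds j : J (inl (inr j)) ->
  measurable_fun (setT : set W) (seeds j : W -> seed_type A).
Proof.
move=> Jj _ U mU; apply: sub_sigma_algebra; exists (inl (inr j)) => //.
by exists U.
Qed.

Lemma measurable_X j t i : J (inr (j, t, i)) ->
  measurable_fun (setT : set W) (X j t i : W -> R).
Proof.
move=> Jj _ U mU; apply: sub_sigma_algebra; exists (inr (j, t, i)) => //.
by exists U.
Qed.

Lemma measurable_sub_algebra (E : set Omega) :
  measurable (E : set W) -> measurable E.
Proof.
move=> sE.
apply: (@g_sigma_algebra_measurable _ _ (\bigcup_(o in J) info o)) sE.
by move=> U [ o _]; exact: info_measurable.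
Qed.

End SubAlgebra.

(** These sources determine the arm of player [j]. They are disjoint for distinct players and avoid
    all exploitation slots. *)
Definition explore_sources j : set source := [set o | match o with
  | inl (inl j') | inl (inr j') => j' = j
  | inr (j', t, _) => j' = j /\ (t < N)%N end].

Definition arm j w :=
  arm_of fallback T subsets (fun j => seeds j) (fun j t i => X j t i) j w.

Lemma arm_sub_algebra J j i : explore_sources j `<=` J ->
  measurable ([set w | arm j w = i] : set (sub_algebra J)).
Proof.
move=> sJ; apply: (@measurable_arm_of _ _ _ A fallback T _ (sub_algebra J)
  subsets (fun j => seeds j : sub_algebra J -> _)
  (fun j t i => X j t i : sub_algebra J -> _) mfallback j i).
- by move=> B; apply: measurable_subsets; exact: sJ.
- by apply: measurable_seeds; exact: sJ.
- by move=> t l tN; apply: measurable_X; apply: sJ.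
Qed.

Lemma measurable_arm j i : measurable [set w | arm j w = i].
Proof.
apply: (@measurable_sub_algebra (explore_sources j)).
by apply: arm_sub_algebra; exact: subset_refl.
Qed.

(** The run uses a fixed set [B] in place of the random subset, so this event is independent of the
    draw of that subset. *)
Definition success j (B : {set 'I_n}) best : set Omega :=
  [set w | output_within (act B 0 (seeds j w)) (fun t l => X j t l w) N =
           Some best].

Lemma success_sub_algebra J j B best :
  explore_sources j `\ inl (inl j) `<=` J ->
  measurable (success j B best : set (sub_algebra J)).
Proof.
move=> sJ; apply: (@measurable_run_rule _ _ A _ (sub_algebra J) (seeds j) (X j)
  N B 0 _ _ _ (stop_rule B 0) N) => //.
- by apply: measurable_seeds; apply: sJ; split.
- by move=> t i tN; apply: measurable_X; apply: sJ; split.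
- exact: measurable_stop_rule.
Qed.

Lemma serial_randomness_player j : serial_randomness nu (seeds j) (X j).
Proof.
case: hrand => _ _ lawS lawX _; split; [exact: lawS|exact: lawX|].
apply: (@mutually_independent_sub _ _ _ P source _ info _
  (fun o : option (nat * 'I_n) =>
   match o with None => inl (inr j) | Some (t, i) => inr (j, t, i) end))
  info_indep.
- by move=> [[t i]|] [[t' i']|] //= [-> ->].
- by move=> [[t i]|].
Qed.

Section Hit.
Variables (c : R) (best : 'I_n).
Hypothesis hA : serial_exploration c A.
Hypothesis hbest : unique_best_in nu [set: 'I_n]%SET best.

(** The serial guarantee at accuracy 0 yields an output within the budget, which persists until the
    halting time; uniqueness forces it to be [best]. *)
Lemma success_ge (B : {set 'I_n}) j :
  best \in B -> serial_budget nu c B 0 best <= N%:R ->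
  ((2 / 3)%:E <= P (success j B best))%E.
Proof.
move=> bB bN.
have bestB : unique_best_in nu B best.
  by split=> // l _ lb; apply: (proj2 hbest) => //; rewrite finset.in_setT.
have le_best l : mean nu l <= mean nu best.
  have [->//|lb] := eqVneq l best.
  by apply/ltW; apply: (proj2 hbest) => //; rewrite finset.in_setT.
have eps01 : 0 <= (0 : R) <= 1 by rewrite lexx ler01.
have bestB' : best_in nu B best by split=> // l _.
apply: (le_trans (hA eps01 bestB' (fun=> bestB) (serial_randomness_player j))).
pose S t i := [set w |
    output_within (act B 0 (seeds j w)) (fun t l => X j t l w) t = Some i].
have mS t i : measurable (S t i).
  apply: (@measurable_run_rule _ _ A _ Omega (seeds j) (X j) t B 0 _ _ _
    (stop_rule B 0) t) => //.
  exact: measurable_stop_rule.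
apply: le_measure; rewrite ?inE.
- apply: measurable_exists_count => t; apply: measurable_exists_count => i.
  rewrite [X in measurable X](_ : _ =
    [set _ | t%:R <= serial_budget nu c B 0 best] `&` (S t i `&`
     [set _ | i \in B /\ mean nu best - 0 <= mean nu i])).
    apply: measurableI; first exact: (measurable_prop _ (_ <= _)).
    by apply: measurableI => //; exact: (measurable_prop _ (_ /\ _)).
  by apply/seteqP; split => w /=; [move=> []|move=> [? [? []]]].
- exact: mS.
move=> w /= [t [i [tb oi iB]]]; rewrite subr0 => bi.
have -> : best = i.
  apply/eqP; apply: contraTT bi; rewrite eq_sym -ltNge => ib.
  by apply: (proj2 hbest) => //; rewrite finset.in_setT.
apply: output_within_mono oi.
by rewrite -(ler_nat R); exact: le_trans tb bN.
Qed.

(** Total probability over the drawn subset, keeping only sets that contain [best] and have an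
    affordable budget: each is drawn with probability ['C(n, m)%:R^-1] and, independently, succeeds
    with probability at least 2/3. *)
Lemma hit_ge j : (0 < m <= n)%N ->
  ((2 / 3 *
    #|[set B in msets best m | serial_budget nu c B 0 best <= N%:R]%SET|%:R /
     'C(n, m)%:R)%:E <= P [set w | arm j w = best])%E.
Proof.
move=> /andP[m0 mn].
rewrite (prob_total P (msubsets j)); last exact: measurable_arm.
set G := [set B in _ | _]%SET.
rewrite (_ : 2 / 3 * #|G|%:R / _ =
  \sum_(B in G) ('C(n, m)%:R^-1 * (2 / 3))); last first.
  by rewrite sumr_const -mulr_natr; ring.
rewrite -sumEFin big_mkcond/=; apply: lee_sum => B _.
case: ifPn => // /[!finset.inE] /andP[/andP[bB /eqP Bm] bN].
apply: (@le_trans _ _ (P (subsets j @^-1` [set B] `&` success j B best))).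
  rewrite (@indep_sources [set inl (inl j)] (explore_sources j `\ inl (inl j))).
  - rewrite EFinM; apply: lee_pmul => //; last exact: success_ge.
    by case: hrand => _ /(_ j B Bm) ->.
  - by apply/seteqP; split => o //= [-> []].
  - exact: measurable_subsets.
  - exact: (success_sub_algebra _ _ (@subset_refl _ _)).
apply: le_measure; rewrite ?inE.
- apply: measurableI; first exact: msubsets.
  exact: (measurable_sub_algebra (success_sub_algebra _ _ (@subset_refl _ _))).
- by apply: measurableI; [exact: measurable_arm|exact: msubsets].
move=> w [/= sB]; rewrite /success/= => E; split=> //.
by rewrite /= /arm /arm_of /explored_arm /explore_policy sB E.
Qed.

End Hit.

Definition arms w : {ffun 'I_k -> 'I_n} := [ffun j => arm j w].

Definition voters w i : nat := #|[pred j | arm j w == i]|.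

Lemma voters_sum w i : (voters w i)%:R = \sum_j \1_[set w | arm j w = i] w :> R.
Proof.
rewrite /voters -sum1_card natr_sum big_mkcond/=; apply: eq_bigr => j _.
rewrite indicE; have -> : (w \in [set w | arm j w = i]) = (arm j w == i).
  by apply/idP/eqP; rewrite inE.
by rewrite inE/=; case: ifP.
Qed.

Lemma explore_sources_disjoint j j' : j != j' ->
  explore_sources j `&` explore_sources j' = set0.
Proof.
move=> jj'; apply/seteqP; split => o //=.
by case: o => [[l|l]|[[l t] i]] /=;
   [case=> -> /eqP|case=> -> /eqP|case=> -[-> _] [/eqP]]; rewrite (negbTE jj').
Qed.

Lemma measurable_few_votes i (x : R) :
  measurable [set w | (voters w i)%:R <= x].
Proof.
rewrite -[X in measurable X]setTI; apply: measurable_fun_le => //.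
rewrite (_ : (fun w => _) = fun w => \sum_j \1_[set w | arm j w = i] w).
  by apply: measurable_sum => j; apply: measurable_indic; exact: measurable_arm.
by apply/funext => w; rewrite voters_sum.
Qed.

(** The expected number of votes [mu] is at least [k%:R * (3 / x) = 3 * x], and Chebyshev bounds the
    probability by [mu / (mu - x) ^+ 2]. *)
Lemma few_votes i (x : R) : 6 <= x -> k%:R = x ^+ 2 ->
  (forall j, ((3 / x)%:E <= P [set w | arm j w = i])%E) ->
  (P [set w | ((voters w i)%:R <= x)%R] <= (8^-1)%:E)%E.
Proof.
move=> x6 kx hit; have x0 : 0 < x by lra.
have mZ j : measurable_fun setT (\1_[set w | arm j w = i] : Omega -> R).
  by apply: measurable_indic; exact: measurable_arm.
pose Z j : {RV P >-> R} := mfun_Sub (mem_set (mZ j)).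
have Z01 j w : 0 <= Z j w <= 1.
  by rewrite /Z /= indicE; case: (_ \in _); rewrite /= ?lexx ?ler01.
have iZ j j' : j \in index_enum 'I_k -> j' \in index_enum 'I_k -> j != j' ->
    indep_rv P (Z j) (Z j').
  move=> _ _ jj' U V mU mV.
  have mW l S : measurable S ->
      measurable (Z l @^-1` S : set (sub_algebra (explore_sources l))).
    move=> mS.
    have := @measurable_indic _ (sub_algebra (explore_sources l)) R setT _
      (arm_sub_algebra i (@subset_refl _ (explore_sources l))) measurableT S mS.
    by rewrite setTI.
  by apply: (indep_sources (explore_sources_disjoint jj')); exact: mW.
have EZ j : fine 'E_P[Z j] = fine (P [set w | arm j w = i]).
  by congr fine; apply: expectation_indic; exact: measurable_arm.
pose mu := \sum_j fine (P [set w | arm j w = i]).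
have mu3 : 3 * x <= mu.
  rewrite (_ : 3 * x = \sum_(j < k) (3 / x)).
    apply: ler_sum => j _; rewrite -lee_fin fineK; first exact: hit.
    by apply: fin_num_measure; exact: measurable_arm.
  by rewrite sumr_const card_ord -[_ *+ k]mulr_natl kx; field; rewrite gt_eqF.
have a0 : 0 < mu - x by lra.
have := chebyshev_sum01 (index_enum_uniq _) iZ Z01 a0.
under eq_bigr do rewrite EZ; rewrite -/mu => cheb.
have devP w : (voters w i)%:R <= x -> mu - x <= `|\sum_j Z j w - mu|.
  move=> vx; rewrite -(voters_sum w i) ler_normr opprB; apply/orP; right.
  by rewrite lerB.
apply: (@le_trans _ _ (P [set w | mu - x <= `|\sum_j Z j w - mu|])).
  apply: le_measure; rewrite ?inE.
  - exact: measurable_few_votes.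
  - rewrite -[X in measurable X]setTI; apply: measurable_fun_le => //.
    apply: measurableT_comp => //; apply: measurable_funB => //.
    exact: measurable_sum.
  - by move=> w /=; exact: devP.
apply: le_trans cheb _; rewrite lee_fin ler_pdivrMr ?exprn_gt0//.
(* From [x <= mu / 3] the square is at least 4/9 of [mu ^+ 2], and [mu >= 18] turns this into
   [8 * mu]. *)
nra.
Qed.

Definition deviates i (x r : R) : set Omega := [set w |
  x < (voters w i)%:R /\
  r <= `|avg_reward (sample_mean T (fun j t i => X j t i) (arms w) w) i
         - mean nu i|].

Definition deviates_at (a : {ffun 'I_k -> 'I_n}) i (r : R) : set Omega :=
  [set w | r <=
    `|avg_reward (sample_mean T (fun j t i => X j t i) a w) i - mean nu i|].

Lemma mean01 i : 0 <= mean nu i <= 1.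
Proof.
have := reward_law01 nu i; rewrite /mean /Rintegral => nu01.
rewrite (@integral_clamp01 _ _ _ (reward_law nu i) id)//.
have h0 : (0%:E <= \int[reward_law nu i]_x (clamp01 (id x))%:E)%E.
  apply: integral_ge0 => x _; rewrite lee_fin.
  by case/andP: (clamp01_ge0_le1 x).
have h1 : (\int[reward_law nu i]_x (clamp01 (id x))%:E <= 1%:E)%E.
  have <- : (\int[reward_law nu i]_x (cst 1%:E) x = 1%:E)%E.
    by rewrite integral_cst//= probability_setT mule1.
  apply: ge0_le_integral => //.
  - by move=> x _; rewrite lee_fin; case/andP: (clamp01_ge0_le1 x).
  - by apply/measurable_EFinP; exact: measurable_clamp01.
  - by move=> x _; rewrite lee_fin; case/andP: (clamp01_ge0_le1 x).
have fin : (\int[reward_law nu i]_x (clamp01 (id x))%:E)%E \is a fin_num.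
  rewrite fin_numE; apply/andP; split.
    by rewrite gt_eqF// (lt_le_trans _ h0)// ltNyr.
  by rewrite lt_eqF// (le_lt_trans h1)// ltry.
by rewrite -!lee_fin fineK// h0.
Qed.

(** Cutting the sources at slot [N] makes the explored arms independent of every average computed
    with frozen arms. *)
Definition all_explore_sources : set source := [set o | match o with
  | inl _ => True | inr (_, t, _) => (t < N)%N end].

Definition exploit_sources : set source := [set o | match o with
  | inl _ => False | inr (_, t, _) => (N <= t)%N end].

Lemma measurable_arms_explore a :
  measurable ([set w | arms w = a] : set (sub_algebra all_explore_sources)).
Proof.
rewrite (_ : mkset _ = [set w | forall j, [set w | arm j w = a j] w]).
  apply: (@measurable_forall_count _ (sub_algebra all_explore_sources)) => j.
  apply: (@arm_sub_algebra _ j) => -[[l|l]|[[l t] i]] //=.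
  by case.
apply/seteqP; split => w /=; first by move=> <- j; rewrite ffunE.
by move=> E; apply/ffunP => j; rewrite ffunE.
Qed.

Lemma measurable_arms a : measurable [set w | arms w = a].
Proof. exact: (measurable_sub_algebra (measurable_arms_explore a)). Qed.

Lemma measurable_deviates_at_exploit a i r :
  measurable (deviates_at a i r : set (sub_algebra exploit_sources)).
Proof.
have mavg : measurable_fun (setT : set (sub_algebra exploit_sources)) (fun w =>
    `|avg_reward (sample_mean T (fun j t i => X j t i) a w) i - mean nu i|).
  apply: measurableT_comp => //; apply: measurable_funB => //.
  apply: (@measurable_avg_reward _ _ _ T _ (sub_algebra exploit_sources)
    (fun j t i => X j t i : sub_algebra exploit_sources -> R)) => j t l tN.
  exact: measurable_X.
rewrite -[X in measurable X]setTI.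
exact: (@measurable_fun_le _ (sub_algebra exploit_sources) _ setT (fun=> r)).
Qed.

Lemma measurable_deviates_at a i r : measurable (deviates_at a i r).
Proof.
exact: (measurable_sub_algebra (measurable_deviates_at_exploit a i r)).
Qed.

Lemma indep_X p q : p != q ->
  indep_rv P (X p.1.1 p.1.2 p.2) (X q.1.1 q.1.2 q.2).
Proof.
move=> pq U V mU mV.
apply: (@indep_sources [set inr p] [set inr q]).
- apply/seteqP; split => o //= [-> [E]].
  by move: pq; rewrite E eqxx.
- apply: sub_sigma_algebra; exists (inr p) => //.
  by case: p {pq} => -[j t] i; exists U; rewrite ?setTI.
- apply: sub_sigma_algebra; exists (inr q) => //.
  by case: q {pq} => -[j t] i; exists V; rewrite ?setTI.
Qed.

(** Every voter averages the same number [N] of rewards, so the mean of the means is one flat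
    mean. *)
Lemma avg_reward_sample_mean (a : {ffun 'I_k -> 'I_n}) i w :
  avg_reward (sample_mean T (fun j t i => X j t i) a w) i =
  (#|[pred j | a j == i]|%:R * N%:R)^-1 *
  \sum_(p <- [seq (j, t) | j <- enum [pred j | a j == i], t <- iota 0 N])
     X p.1 (N + p.2)%N i w.
Proof.
rewrite big_allpairs big_enum/= invfM -mulrA; congr (_ * _).
rewrite mulr_sumr; apply: eq_bigr => j aj.
by move/eqP: aj => /= aj; rewrite /sample_mean/= aj.
Qed.

(** Chebyshev for [V * N] pairwise independent rewards, whose common mean is at most 1, followed by
    [x < V]. *)
Lemma deviates_at_le (a : {ffun 'I_k -> 'I_n}) i (x r : R) :
  0 < x -> 0 < r -> (0 < N)%N ->
  x < #|[pred j | a j == i]|%:R ->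
  (P (deviates_at a i r) <= ((r ^+ 2 * x * N%:R)^-1)%:E)%E.
Proof.
move=> x0 r0 N0; set V := #|_| => xV.
have V0 : 0 < V%:R :> R by exact: lt_trans xV.
have N0' : 0 < N%:R :> R by rewrite ltr0n.
pose s := [seq (j, t) | j <- enum [pred j | a j == i], t <- iota 0 N].
have us : uniq s.
  by rewrite allpairs_uniq ?enum_uniq ?iota_uniq// => -[? ?] [? ?].
have ss : size s = (V * N)%N by rewrite size_allpairs size_iota -cardE.
pose Z (p : 'I_k * nat) : {RV P >-> R} := X p.1 (N + p.2)%N i.
have iZ p q : p \in s -> q \in s -> p != q -> indep_rv P (Z p) (Z q).
  move=> _ _ pq; apply: (@indep_X (p.1, (N + p.2)%N, i) (q.1, (N + q.2)%N, i)).
  apply: contra pq => /eqP[E1 /addnI E2].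
  by rewrite [p]surjective_pairing [q]surjective_pairing E1 E2.
have lawX j t l U :
    measurable U -> distribution P (X j t l) U = reward_law nu l U.
  by case: hrand => _ _ _ lX _; exact: lX.
have Z01 p : P (Z p @^-1` `[0, 1]) = 1%E.
  by rewrite -(reward_law01 nu i) -(lawX p.1 (N + p.2)%N).
have EZ p : fine 'E_P[Z p] = mean nu i.
  by apply: expectation_law; [move=> U mU; exact: lawX | exact: reward_law01].
have rVN : 0 < r * (V%:R * N%:R) by rewrite !mulr_gt0.
have := chebyshev_sum_law us iZ Z01 EZ rVN.
have -> : \sum_(p <- s) mean nu i = (V%:R * N%:R) * mean nu i.
  rewrite big_const_seq count_predT ss iter_addr_0.
  by rewrite -[_ *+ (V * N)]mulr_natl natrM.
move=> cheb; apply: le_trans (le_trans _ cheb) _.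
  rewrite le_eqVlt; apply/orP; left; apply/eqP; congr (P _).
  apply/eq_set => w; rewrite avg_reward_sample_mean -/V -/s.
  set S := \sum_(p <- s) _.
  have -> : (V%:R * N%:R)^-1 * S - mean nu i =
      (V%:R * N%:R)^-1 * (S - V%:R * N%:R * mean nu i).
    by field; rewrite !gt_eqF.
  rewrite normrM gtr0_norm ?invr_gt0 ?mulr_gt0// mulrC ler_pdivlMr//.
  by rewrite mulr_gt0.
rewrite lee_fin.
have [p0 p1] := andP (mean01 i).
rewrite (@le_trans _ _ ((r ^+ 2 * (V%:R * N%:R))^-1))//.
  rewrite ler_pdivrMr ?exprn_gt0//.
  rewrite (_ : _^-1 * _ = V%:R * N%:R); last by field; rewrite !gt_eqF.
  by rewrite ler_piMr// mulr_ge0// ltW.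
rewrite lef_pV2 ?posrE ?mulr_gt0 ?exprn_gt0//.
by rewrite -mulrA ler_pM2l ?exprn_gt0// ler_pM2r// ltW.
Qed.

Lemma deviatesE i x r : deviates i x r =
  [set w | exists a, [set w | arms w = a] w /\
   [set w | x < #|[pred j | a j == i]|%:R /\ deviates_at a i r w] w].
Proof.
apply/seteqP; split => w; rewrite /deviates /deviates_at /=.
  move=> [h1 h2]; exists (arms w); split=> //; split=> //.
  rewrite (@eq_card _ _ [pred j | arm j w == i])// => j.
  by rewrite !inE ffunE.
move=> [a [aw [h1 h2]]]; rewrite aw; split=> //.
rewrite /voters (@eq_card _ _ [pred j | a j == i])// => j.
by rewrite !inE -aw ffunE.
Qed.

Lemma measurable_deviates i x r : measurable (deviates i x r).
Proof.
rewrite deviatesE; apply: measurable_exists_count => a.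
apply: measurableI; first exact: measurable_arms.
apply: measurableI; first exact: (measurable_prop _ (_ < _)).
exact: measurable_deviates_at.
Qed.

Lemma deviates_le i (x r : R) : 0 < x -> 0 < r -> (0 < N)%N ->
  (P (deviates i x r) <= ((r ^+ 2 * x * N%:R)^-1)%:E)%E.
Proof.
move=> x0 r0 N0; set e := _^-1.
have e0 : 0 <= e by rewrite invr_ge0 !mulr_ge0// ?sqr_ge0// ltW.
have mdev := measurable_deviates i x r.
rewrite (prob_total P measurable_arms)//.
apply: (@le_trans _ _ (\sum_a e%:E * P [set w | arms w = a])%E).
  apply: lee_sum => a _.
  have [xa|xa] := ltP x #|[pred j | a j == i]|%:R; last first.
    rewrite (_ : _ `&` _ = set0) ?measure0 ?mule_ge0//.
    apply/seteqP; split => w //; rewrite deviatesE => -[[b [/= <- [xb _]]] ab].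
    by move: xa; rewrite -ab leNgt xb.
  apply: (@le_trans _ _ (P (deviates_at a i r) * P [set w | arms w = a])%E).
    rewrite -(@indep_sources exploit_sources all_explore_sources).
    - apply: le_measure; rewrite ?inE.
      + by apply: measurableI => //; exact: measurable_arms.
      + apply: measurableI; first exact: measurable_deviates_at.
        exact: measurable_arms.
      + by move=> w; rewrite deviatesE => -[[b [/= <- [_ h]]] ab]; rewrite -ab.
    - apply/seteqP; split => -[l|[[j t] l]] [] //= h1 h2.
      by exfalso; lia.
    - exact: measurable_deviates_at_exploit.
    - exact: measurable_arms_explore.
  by apply: lee_wpmul2r => //; exact: deviates_at_le.
rewrite -ge0_sume_distrr//.
have := prob_total P measurable_arms measurableT.
rewrite probability_setT; under eq_bigr do rewrite setTI.
by move=> <-; rewrite mule1.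
Qed.

End OneRoundAnalysis.

(** * Correctness of the argmax when the averages are accurate *)

Section Choice.
Context (R : realType) (n k : nat).

(** The midpoint between the means of [l] and [best] separates their averages. The maximizer is then
    unique, so tie-breaking cannot matter. *)
Lemma maximizers_best (msg : 'I_k -> message R n) (mu : 'I_n -> R)
    (best : 'I_n) :
  Num.sqrt k%:R < (votes msg best)%:R :> R ->
  (forall l, l != best -> Num.sqrt k%:R < (votes msg l)%:R :> R ->
     `|avg_reward msg l - mu l| < (mu best - mu l) / 2) ->
  (forall l, l != best ->
     `|avg_reward msg best - mu best| < (mu best - mu l) / 2) ->
  maximizers msg = [set best]%SET.
Proof.
move=> vbest dev devb.
have lt_best l : l \in candidates msg -> l != best ->
    avg_reward msg l < avg_reward msg best.
  rewrite finset.inE => vl lb.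
  have := dev _ lb vl; have := devb _ lb; rewrite !ltr_norml; lra.
have cbest : best \in candidates msg by rewrite finset.inE.
apply/setP => l; rewrite finset.in_set1 /maximizers finset.in_set.
have [->|lb] := eqVneq l best.
  rewrite cbest; apply/forallP => q; apply/implyP => cq.
  by have [->//|qb] := eqVneq q best; apply/ltW/lt_best.
apply/negP => /andP[cl /forallP/(_ best)]; rewrite cbest/= leNgt.
by rewrite lt_best.
Qed.

End Choice.

(** * Bounds on the gaps, the complexity and the serial budgets *)

Section Complexity.
Context (R : realType) (n : nat) (nu : bandit R n) (best : 'I_n).
Hypothesis hbest : unique_best_in nu [set: 'I_n]%SET best.

Definition weight i : R := gap nu best i ^- 2 * ln (n%:R / gap nu best i).

Lemma gap_gt0 i : i != best -> 0 < gap nu best i.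
Proof.
by move=> ib; rewrite subr_gt0; apply: (proj2 hbest); rewrite // finset.in_setT.
Qed.

Lemma gap_le1 i : gap nu best i <= 1.
Proof. by rewrite /gap; have := mean01 nu best; have := mean01 nu i; lra. Qed.

(** From [1 + y <= expR y] at [y = - 2^-1], squared after inversion. *)
Lemma expR1_le4 : expR 1 <= 4 :> R.
Proof.
have h : 2^-1 <= expR (- 2^-1) :> R by apply: le_trans (expR_ge1Dx _); lra.
have -> : expR 1 = (expR (- 2^-1))^-1 ^+ 2 :> R.
  by rewrite -expRN opprK expr2 -expRD; congr expR; field.
have -> : 4 = (2^-1)^-1 ^+ 2 :> R by field.
rewrite ler_sqr ?nnegrE ?invr_ge0 ?expR_ge0//.
by rewrite lef_pV2 ?posrE ?expR_gt0.
Qed.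

Lemma ln_ge1 (x : R) : 4 <= x -> 1 <= ln x.
Proof.
move=> x4; rewrite -ler_expR lnK ?posrE; last by lra.
exact: le_trans expR1_le4 x4.
Qed.

Hypothesis n6 : (6 <= n)%N.
Let n6R : 6 <= n%:R :> R. Proof. by rewrite ler_nat. Qed.

Lemma ln_gap_ge1 i : i != best -> 1 <= ln (n%:R / gap nu best i).
Proof.
move=> ib; apply: ln_ge1; rewrite ler_pdivlMr ?gap_gt0//.
by have := gap_le1 i; have := gap_gt0 ib; have := n6R; lra.
Qed.

Lemma weight_ge i : i != best -> gap nu best i ^- 2 <= weight i.
Proof.
move=> ib; rewrite ler_peMr ?invr_ge0 ?sqr_ge0//; exact: ln_gap_ge1.
Qed.

Lemma weight_ge1 i : i != best -> 1 <= weight i.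
Proof.
move=> ib; apply: le_trans (weight_ge ib).
rewrite invf_ge1 ?exprn_gt0 ?gap_gt0// expr_le1// ?gap_le1// ltW// gap_gt0//.
Qed.

Lemma complexity_ge : n%:R - 1 <= complexity nu best.
Proof.
rewrite /complexity -/weight.
apply: (@le_trans _ _ (\sum_(i | i != best) 1)).
  rewrite sumr_const cardC1 card_ord -subn1 natrB//; exact: leq_trans n6.
by apply: ler_sum => i ib; exact: weight_ge1.
Qed.

(** At accuracy 0 the scale of an arm is its gap, and [#|B|] is at most [n]. The right-hand side has
    the form required by [markov_msets]. *)
Lemma serial_budget_le (c : R) (B : {set 'I_n}) : 0 <= c -> best \in B ->
  serial_budget nu c B 0 best <=
  \sum_(i in B | i != best) (if i == best then 0 else c * weight i).
Proof.
move=> c0 bB; rewrite /serial_budget mulr_sumr.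
apply: ler_sum => i /andP[iB ib].
rewrite (negbTE ib) -/(gap nu best i) max_l; last by rewrite ltW// gap_gt0.
rewrite ler_wpM2l// ler_wpM2l ?invr_ge0 ?sqr_ge0//.
have B0 : (0 < #|B|)%N by apply/card_gt0P; exists best.
rewrite ler_ln ?posrE ?divr_gt0 ?gap_gt0 ?ltr0n//; last exact: leq_trans n6.
rewrite ler_pM2r ?invr_gt0 ?gap_gt0// ler_nat.
by rewrite -[leqRHS]card_ord max_card.
Qed.

(** Here [T] stands for the exploration length. Sets containing [best] make up a fraction [6 / x] of
    all, and a budget has mean at most [6 * c / x] times the complexity. Since [T] is at least 8
    times that bound, Markov discards at most one eighth of them. *)
Lemma good_msets (c x : R) (m T : nat) : 1 < c -> 0 < x -> (0 < m <= n)%N ->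
  m%:R = 6 * n%:R / x ->
  96 * c * (x^-1 * complexity nu best) <= 2 * T%:R ->
  3 / x <= 2 / 3 * #|[set B in msets best m |
     serial_budget nu c B 0 best <= T%:R]%SET|%:R / 'C(n, m)%:R.
Proof.
move=> c1 x0 /andP[m0 mn] mE hT.
set good := [set B in _ | _]%SET.
pose v i := if i == best then 0 else c * weight i.
have v0 i : 0 <= v i.
  rewrite /v; case: ifPn => // ib; rewrite mulr_ge0//; first lra.
  by have := weight_ge1 ib; lra.
have := markov_msets best m0 mn T%:R v0.
set bad := [set B in _ | _]%SET.
have -> : \sum_(i | i != best) v i = c * complexity nu best.
  rewrite mulr_sumr; apply: eq_bigr => i ib; by rewrite /v (negbTE ib).
set H := complexity nu best in hT *.
move=> mk.
have H0 : 0 < H by have := complexity_ge; rewrite -/H; have := n6R; lra.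
(* A set whose budget exceeds [T] also has an upper bound exceeding [T], so it is counted in
   [bad]. *)
have gb : (#|msets best m| <= #|good| + #|bad|)%N.
  rewrite -cardsUI (leq_trans _ (leq_addr _ _))//.
  apply: subset_leq_card; apply/fintype.subsetP => B mB.
  rewrite finset.in_setU !finset.in_set.
  move: mB; rewrite /msets finset.in_set => mB.
  rewrite mB/=; case: ltP => [_|le]; rewrite ?orbT// orbF.
  by apply: le_trans le; apply: serial_budget_le; [lra|case/andP: mB].
have n0 : 0 < n%:R :> R by have := n6R; lra.
have C0 : 0 < 'C(n, m)%:R :> R by rewrite ltr0n bin_gt0.
have MC : #|msets best m|%:R = 6 / x * 'C(n, m)%:R :> R.
  have := bin_msets best m0 mn => /(congr1 (fun q => q%:R : R)).
  rewrite !natrM mE.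
  move=> E; apply: (mulfI (lt0r_neq0 n0)); rewrite E; field; exact: lt0r_neq0.
move: gb; rewrite -(ler_nat R) natrD.
move: mk; rewrite mE MC.
set g := #|good|%:R; set b := #|bad|%:R; set Cb := _%:R in C0 MC *.
move=> mk gb.
have b0 : 0 <= b by rewrite ler0n.
have cH : 48 * (c * H) / x <= T%:R by move: hT; rewrite mulrC -!mulrA; lra.
have cH0 : 0 < c * H by rewrite mulr_gt0//; lra.
have h1 : 48 * b <= 6 * (6 / x * Cb).
  have := mk; rewrite (_ : 6 * n%:R / x * (6 / x * Cb) * (c * H) =
    (c * H / x) * n%:R * (6 * (6 / x * Cb))); last by field; exact: lt0r_neq0.
  move=> mk'.
  have q0 : 0 < c * H / x * n%:R by rewrite mulr_gt0// divr_gt0.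
  rewrite -(ler_pM2l q0); apply: le_trans mk'.
  have nb0 : 0 <= n%:R * b by rewrite mulr_ge0// ltW.
  have := ler_wpM2r nb0 cH.
  rewrite (_ : 48 * (c * H) / x * (n%:R * b) =
    c * H / x * n%:R * (48 * b)); last by ring.
  by rewrite (_ : T%:R * (n%:R * b) = n%:R * T%:R * b)//; ring.
rewrite ler_pdivlMr//.
(* The target is half of [#|msets best m|], while the surviving share is 2/3 times 7/8, that is,
   7/12. *)
have -> : 3 / x * Cb = (6 / x * Cb) / 2 by field; exact: lt0r_neq0.
have : 0 <= 6 / x * Cb by rewrite mulr_ge0// ?divr_ge0// ltW.
move: gb h1; set M := 6 / x * Cb; lra.
Qed.

End Complexity.

(** * Combination of the failure events *)

Section Identification.
Context (R : realType) (c : R) (k n m : nat) (A : procedure R n)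
  (nu : bandit R n) (best : 'I_n)
  (fallback : 'I_k -> {set 'I_n} -> seed_type A -> history R n -> 'I_n)
  (choose : {set 'I_n} -> 'I_n)
  d (Omega : measurableType d) (P : probability Omega R)
  (subsets : 'I_k -> Omega -> {set 'I_n})
  (seeds : 'I_k -> {RV P >-> seed_type A})
  (X : 'I_k -> nat -> 'I_n -> {RV P >-> R}) (T : nat).
Local Notation x := (Num.sqrt (k%:R : R)).
Hypotheses (hc : 1 < c) (hk : 6 <= x) (hkn : x <= n%:R)
  (hm : m%:R = 6 * n%:R / x).
Hypothesis hA : serial_exploration c A.
Hypothesis hbest : unique_best_in nu [set: 'I_n]%SET best.
Hypothesis hfallback : forall j B, measurable_rule (fallback j B).
Hypothesis hchoose :
  forall (B : {set 'I_n}) (i : 'I_n), i \in B -> choose B \in B.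
Hypothesis hrand : one_round_randomness m nu subsets seeds X.
Hypothesis evenT : ~~ odd T.
Hypothesis hT : 96 * c * (x^-1 * complexity nu best) <= T%:R.

Local Notation N := T./2.
Local Notation H := (complexity nu best).
Local Notation dev := (deviates nu fallback subsets seeds X T).
Local Notation vote := (voters fallback subsets seeds X T).
Local Notation result w := (output (exec_of fallback choose T subsets
  (fun j => seeds j) (fun j t i => X j t i) w)).

Let x0 : 0 < x. Proof. by apply: lt_le_trans hk; rewrite ltr0n. Qed.
Let n6 : (6 <= n)%N. Proof. by rewrite -(ler_nat R); apply: le_trans hkn. Qed.

Let T2N : T%:R = 2 * N%:R :> R.
Proof.
by rewrite -[T in LHS]odd_double_half (negbTE evenT) add0n -muln2 natrM mulrC.
Qed.

Let H1 : 1 <= H.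
Proof.
have := complexity_ge hbest n6.
have : 6 <= n%:R :> R by rewrite ler_nat.
lra.
Qed.

(** The horizon hypothesis as used for exploitation: [x * N%:R] bounds from below the number of
    rewards behind a candidate, and [1 < c] removes [c]. *)
Let xN : 48 * H <= x * N%:R.
Proof.
have : 96 * c * (x^-1 * H) <= 2 * N%:R by rewrite -T2N.
rewrite mulrCA mulrC -ler_pdivlMr ?invr_gt0// invrK => h.
suff : 48 * H <= 48 * (c * H) by move: h; rewrite -mulrA; lra.
by rewrite ler_pM2l// ler_peMl ?ltW//; have := H1; lra.
Qed.

Let N0 : (0 < N)%N.
Proof.
rewrite -(ltr_nat R) -(pmulr_rgt0 _ x0); apply: lt_le_trans xN.
by have := H1; lra.
Qed.

Lemma hit_best j :
  ((3 / x)%:E <= P [set w | arm fallback subsets seeds X T j w = best])%E.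
Proof.
have m0n : (0 < m <= n)%N.
  rewrite -(ltr_nat R) -(ler_nat R) hm.
  have n0 : 0 < n%:R :> R by apply: lt_le_trans hkn.
  rewrite divr_gt0 ?mulr_gt0//= ler_pdivrMr// mulrC ler_pM2l//.
apply: le_trans (hit_ge T hfallback hrand hA hbest j m0n).
by rewrite lee_fin; apply: good_msets => //; rewrite -T2N.
Qed.

(** The average of [best] is tested at the scale of every rival, next to the average of that
    rival. *)
Definition misled : set Omega := [set w | exists2 l, l != best &
  (dev l x (gap nu best l / 2) `|` dev best x (gap nu best l / 2)) w].

Let mdev i y r : measurable (dev i y r).
Proof. exact: (measurable_deviates T hfallback hrand). Qed.

Lemma measurable_misled : measurable misled.
Proof.
rewrite (_ : misled = [set w | exists l, [set w | l != best /\
  (dev l x (gap nu best l / 2) `|` dev best x (gap nu best l / 2)) w] w]).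
  apply: measurable_exists_count => l; apply: measurableI.
    exact: (measurable_prop _ (l != best)).
  exact: measurableU.
by apply/seteqP; split => w /= [l]; [exists l|case=> lb ?; exists l].
Qed.

(** At scale half a gap, each deviation has probability at most [(12 * H)^-1] times the weight of
    the rival. There are two per rival and the weights sum to [H], giving 2/12. *)
Lemma misled_le : (P misled <= (6^-1)%:E)%E.
Proof.
apply: (le_trans (prob_exists_le P (fun l => l != best)
  (fun l => measurableU _ _ (mdev l x (gap nu best l / 2))
                            (mdev best x (gap nu best l / 2))))).
have devle i l : l != best ->
    (P (dev i x (gap nu best l / 2)) <= ((12 * H)^-1 * weight nu best l)%:E)%E.
  move=> lb; have g0 := gap_gt0 hbest lb.
  have g20 : 0 < gap nu best l / 2 by rewrite divr_gt0.
  apply: (le_trans (deviates_le hfallback hrand i x0 g20 N0)); rewrite lee_fin.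
  apply: (@le_trans _ _ ((12 * H)^-1 * gap nu best l ^- 2)); last first.
    rewrite ler_wpM2l//; last exact: weight_ge.
    by rewrite invr_ge0; have := H1; lra.
  have H0 : 0 < H by exact: lt_le_trans H1.
  rewrite -invfM lef_pV2 ?posrE ?mulr_gt0 ?exprn_gt0 ?ltr0n//.
  have := ler_wpM2r (sqr_ge0 (gap nu best l)) xN.
  have -> : (gap nu best l / 2) ^+ 2 * x * N%:R =
      x * N%:R * gap nu best l ^+ 2 / 4.
    by field.
  lra.
apply: (@le_trans _ _
  (\sum_(l | l != best) (2 * ((12 * H)^-1 * weight nu best l))%:E)%E).
  apply: lee_sum => l lb; apply: (le_trans (measureU2 _ _ _)) => //.
  rewrite mulr_natl mulr2n EFinD; apply: leeD; exact: devle.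
rewrite sumEFin lee_fin -mulr_sumr -mulr_sumr -/(complexity nu best).
have H0 : 0 < H by exact: lt_le_trans H1.
rewrite le_eqVlt; apply/orP; left; apply/eqP.
by field; rewrite gt_eqF.
Qed.

Lemma identified w : ~ [set w | (vote w best)%:R <= x] w -> ~ misled w ->
  result w = best.
Proof.
move=> nV nm; rewrite output_exec_of.
move: nV => /= /negP; rewrite -ltNge => vb.
set msg := sample_mean _ _ _ _.
have vE i : votes msg i = vote w i.
  by rewrite /votes /voters; apply: eq_card => j; rewrite !inE /= ffunE.
rewrite (@maximizers_best _ _ _ msg (mean nu) best).
- have : choose [set best]%SET \in [set best]%SET.
    by apply: hchoose; exact: set11.
  by rewrite finset.in_set1 => /eqP.
- by rewrite vE.
- move=> l lb vl; rewrite ltNge; apply/negP => dl.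
  apply: nm; exists l => //; left.
  by split; rewrite -?vE.
- move=> l lb; rewrite ltNge; apply/negP => dl.
  apply: nm; exists l => //; right.
  by split.
Qed.

(** The two failure probabilities add up to 1/8 + 1/6 = 7/24, below 1/3. *)
Lemma one_round_success : ((2 / 3)%:E <= P [set w |
  result w = best])%E.
Proof.
set S := mkset _; pose V := [set w | (vote w best)%:R <= x].
have mV : measurable V by exact: (measurable_few_votes T hfallback hrand).
have mM := measurable_misled.
have PF : (P (V `|` misled) <= (8^-1 + 6^-1)%:E)%E.
  apply: (le_trans (measureU2 _ _ _)) => //.
  rewrite EFinD; apply: leeD misled_le.
  by apply: (few_votes hfallback hrand hk _ hit_best); rewrite sqr_sqrtr.
have mF : measurable (V `|` misled) by exact: measurableU.
apply: (@le_trans _ _ (P (~` (V `|` misled)))).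
  rewrite probability_setC//.
  apply: (@le_trans _ _ (1 - (8^-1 + 6^-1)%:E)%E); last exact: leeB.
  by rewrite -EFinB lee_fin; lra.
apply: le_measure; rewrite ?inE.
- exact: measurableC.
- apply: measurable_output => //.
  by case: hrand.
- by move=> w /= /not_orP[nV nM]; apply: identified.
Qed.

End Identification.

Theorem theorem3p1 (R : realType) (c : R) (hc : 1 < c) :
  exists C C' : R, 0 < C /\
  forall (k n m : nat)
    (hk : 6 <= Num.sqrt (k%:R : R)) (hkn : Num.sqrt (k%:R : R) <= n%:R)
    (hm : m%:R = 6 * n%:R / Num.sqrt (k%:R : R))
    (A : procedure R n) (hA : serial_exploration c A)
    (nu : bandit R n) (best : 'I_n)
    (hbest : unique_best_in nu [set: 'I_n]%SET best)
    (fallback : 'I_k -> {set 'I_n} -> seed_type A -> history R n -> 'I_n)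
    (hfallback : forall j B, measurable_rule (fallback j B))
    (choose : {set 'I_n} -> 'I_n)
    (hchoose : forall (B : {set 'I_n}) (i : 'I_n), i \in B -> choose B \in B)
    (d : measure_display) (Omega : measurableType d) (P : probability Omega R)
    (subsets : 'I_k -> Omega -> {set 'I_n})
    (seeds : 'I_k -> {RV P >-> seed_type A})
    (X : 'I_k -> nat -> 'I_n -> {RV P >-> R})
    (hrand : one_round_randomness m nu subsets seeds X),
  let exec (T : nat) (w : Omega) : execution R n k :=
    one_round_best_arm fallback choose T
      (fun j => subsets j w) (fun j => seeds j w) (fun j t i => X j t i w) in
  let bound : R := (Num.sqrt k%:R)^-1 * complexity nu best in
  (forall T : nat, ~~ odd T -> C * bound <= T%:R ->
     ((2 / 3)%:E <= P [set w | output (exec T w) = best])%E /\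
     (forall w j, (pulls (exec T w) j <= T)%N))
  /\
  (exists T : nat, ~~ odd T /\
     ((2 / 3)%:E <= P [set w | output (exec T w) = best])%E /\
     (forall w j, (pulls (exec T w) j)%:R <= C' * bound))
  /\
  (forall (T : nat) (w : Omega), size (rounds (exec T w)) = 1%N /\
     forall (b : nat) (j : 'I_k), (bits_sent b (exec T w) j <= up_log 2 n + b)%N).
Proof.
(* The extra 4 in [C'] pays for rounding the horizon up to an even integer. *)
exists (96 * c), (96 * c + 4); split; first by rewrite mulr_gt0//; lra.
move=> k n m hk hkn hm A hA nu best hbest fallback hfallback choose hchoose
  d Omega P subsets seeds X hrand exec bound.
have pulls_le T w j : (pulls (exec T w) j <= T)%N.
  rewrite /= size_map size_iota -[leqRHS]odd_double_half -addnn.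
  rewrite (leq_trans _ (leq_addl _ _))// leq_add2r; exact: size_run.
have success T : ~~ odd T -> 96 * c * bound <= T%:R ->
    ((2 / 3)%:E <= P [set w | output (exec T w) = best])%E.
  move=> oT hT.
  exact: (one_round_success hc hk hkn hm hA hbest hfallback hchoose hrand).
split; first by move=> T oT hT; split; [exact: success|exact: pulls_le].
split; last first.
  by move=> T w; split=> // b j; rewrite /bits_sent /= big_seq1.
have x0 : 0 < Num.sqrt k%:R :> R by apply: lt_le_trans hk; rewrite ltr0n.
have n6 : 6 <= n%:R :> R by exact: le_trans hkn.
(* The complexity is at least [n%:R - 1] and the square root at most [n%:R], so [bound] is at least
   (n-1)/n. *)
have bound_ge : 2^-1 <= bound.
  have := complexity_ge hbest; rewrite -(ler_nat R) => /(_ n6) h.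
  rewrite /bound mulrC ler_pdivlMr//; lra.
have y0 : 0 <= 96 * c * bound / 2 by rewrite divr_ge0// mulr_ge0//; lra.
have /andP[ty yt] := truncn_itv y0.
set t := Num.truncn _ in ty yt.
(* This even horizon is at least [96 * c * bound] and exceeds it by at most 2, which is at most
   [4 * bound]. *)
exists (t.+1).*2; split; first by rewrite odd_double.
have T2 : (t.+1).*2%:R = 2 * t.+1%:R :> R by rewrite -muln2 natrM mulrC.
split; first by apply: success; [rewrite odd_double|rewrite T2; lra].
move=> w j; apply: (@le_trans _ _ (t.+1).*2%:R); first by rewrite ler_nat.
by rewrite T2 -natr1; lra.
Qed.
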